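(* Let $P$ be a convex $n$-gon ($n\ge3$) whose vertices, in counterclockwise order, are $1$, then the even labels $2,4,6,\dots$ in increasing order, then the odd labels $\ge3$ in decreasing order (so the last three in the middle of this list are $\dots,n-2,n,n-1,\dots$ or $\dots,n-1,n,n-2,\dots$). Let $T$ be the zig-zag triangulation with diagonals $(j,j+1)$, $2\le j\le n-2$, each oriented $j\to j+1$; its triangles are $\Delta_j=(j,j+1,j+2)$, $1\le j\le n-2$, with initial μ-invariants $\theta_j$, and $\lambda_{ij}$ denote initial λ-lengths. For $1\le k\le n-2$, perform the super Ptolemy flips of $(n-2,n-1),(n-3,n-2),\dots,(k+1,k+2)$ in this order (the flip of $(j,j+1)$ replaces it by $(j-1,n)$); let $\lambda_{kn}$ be the resulting λ-length of $(k,n)$ and $\boxed{k,k+1,n}$ the resulting μ-invariant of the triangle $(k,k+1,n)$ (for $k=n-2$ no flip is done and $\boxed{n-2,n-1,n}=\theta_{n-2}$). Then (a) $\displaystyle\sqrt{\frac{\lambda_{kn}\lambda_{k+1,n}}{\lambda_{k,k+1}}}\;\boxed{k,k+1,n}=\sum_{i=k}^{n-2}\ \sum_{t\in\mathcal T_{i+1,n}}\mathrm{wt}(t)\,\mathrm{wt}(\sigma_i)$; (b) $\displaystyle\lambda_{kn}=\sum_{t\in\mathcal T_{k,n}}\mathrm{wt}(t)$.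
   Context: Algebra: λ-lengths even with positive body, μ-invariants odd (anticommuting, square zero); square roots of even elements with positive body, chosen with positive body. Super Ptolemy flip: for a diagonal $e$ oriented from $P_1$ to $R$ in quadrilateral $P_1QRS$ with triangle $P_1RS$ (μ-invariant $\theta$) to the left of $e$ and $P_1QR$ (μ-invariant $\sigma$) to the right, and $a,b,c,d$ the λ-lengths of $P_1S,SR,RQ,QP_1$: $e$ is replaced by $f=QS$ oriented $Q\to S$ with $ef=ac+bd+\sqrt{abcd}\,\sigma\theta$; triangle $QSP_1$ (left of $f$) gets $\theta'=(\theta\sqrt{bd}+\sigma\sqrt{ac})/\sqrt{ac+bd}$, triangle $QRS$ (right of $f$) gets $\sigma'=(\sigma\sqrt{bd}-\theta\sqrt{ac})/\sqrt{ac+bd}$; the orientation of side $SR$ is reversed. $\sigma$-edges and weights: $\sigma_j$ joins a new vertex $\theta_j$ inside $\Delta_j$ to vertex $j+1$, with $\mathrm{wt}(\sigma_j)=\sqrt{\lambda_{j,j+2}/(\lambda_{j,j+1}\lambda_{j+1,j+2})}\;\theta_j$. Positive ordering on $\theta_1,\dots,\theta_{n-2}$: for each $1\le j\le n-3$, if $\Delta_j$ lies to the right of the oriented diagonal $d_j=(j+1\to j+2)$ then $\theta_j>\theta_i$ for all $i>j$, and otherwise $\theta_j<\theta_i$ for all $i>j$. Super $T$-paths from $i$ to $n$ ($1\le i\le n-1$): if $(i,n)$ is an arc of $T$ (i.e. $i\in\{n-2,n-1\}$), $\mathcal T_{i,n}$ consists of the single edge $(i,n)$. Otherwise use the sub-polygon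 formed by $\Delta_i,\dots,\Delta_{n-2}$; auxiliary graph: its vertices plus $\theta_i,\dots,\theta_{n-2}$; edges: sides of these triangles, $\sigma_i,\dots,\sigma_{n-2}$, and $\tau_{jl}=(\theta_j,\theta_l)$ for $j<l$. The diagonals $d_j$ ($i\le j\le n-3$, position $j+\frac12$) and $\sigma_j$ (position $j$) cross $(i,n)$; no others. A super $T$-path is $(a_0=i,\dots,a_\ell=n\mid t_1,\dots,t_\ell)$ with $t_s$ an edge joining $a_{s-1},a_s$, pairwise distinct edges, $\ell$ odd, $t_s$ crossing $(i,n)$ for even $s$, $\sigma$-edges only at even and $\tau$-edges only at odd steps, and crossing edges in strictly increasing position. Weight: arc $(p,q)$ at step $s$ contributes $\lambda_{pq}$ ($s$ odd) or $\lambda_{pq}^{-1}$ ($s$ even), $\sigma_j$ contributes $\mathrm{wt}(\sigma_j)$, $\tau$-edges $1$; odd generators are written in decreasing positive ordering. *)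

(* Defs.v *)
From HB Require Import structures.
From mathcomp Require Import all_boot all_order all_algebra.
From mathcomp Require Import finmap.
From mathcomp Require Import boolp classical_sets fsbigop reals.

Set Implicit Arguments.
Unset Strict Implicit.
Unset Printing Implicit Defensive.

Import GRing.Theory Num.Theory.

Local Open Scope classical_set_scope.
Local Open Scope fset_scope.
Local Open Scope ring_scope.

(* Supercommutative real algebra with a body map whose kernel (the soul) is
   nil; the real Grassmann algebras are the motivating examples.  Odd elements
   square to zero because 2 is invertible, hence they have body 0. *)
Record superAlgebra (R : realType) := SuperAlgebra {
  sa_sort :> unitAlgType R;
  even_part : {pred sa_sort};
  odd_part : {pred sa_sort};
  even_submod : submod_closed even_part;
  odd_submod : submod_closed odd_part;
  even_odd_sum : forall x,
    exists u v, [/\ u \in even_part, v \in odd_part & x = u + v];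
  even_odd_direct : forall x, x \in even_part -> x \in odd_part -> x = 0;
  even_one : 1 \in even_part;
  even_mul_even : forall x y,
    x \in even_part -> y \in even_part -> x * y \in even_part;
  even_mul_odd : forall x y,
    x \in even_part -> y \in odd_part -> x * y \in odd_part;
  odd_mul_odd : forall x y,
    x \in odd_part -> y \in odd_part -> x * y \in even_part;
  even_central : forall x y, x \in even_part -> x * y = y * x;
  odd_anticomm : forall x y,
    x \in odd_part -> y \in odd_part -> x * y = - (y * x);
  body : {rmorphism sa_sort -> R};
  body_scalar : forall c : R, body (c%:A) = c;
  soul_nil : forall x, body x = 0 -> exists m, x ^+ m = 0
}.

Arguments even_part {R} s.
Arguments odd_part {R} s.
Arguments body {R} s.

Definition even_pos (R : realType) (A : superAlgebra R) (x : A) : Prop :=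
  x \in even_part A /\ 0 < body A x.

(* The choice is unique when x is even with positive body. *)
Definition ssqrt (R : realType) (A : superAlgebra R) (x : A) : A :=
  xget 0 [set y : A | even_pos y /\ y ^+ 2 = x].

(* Vertices are labelled 1, ..., n; this lists them counterclockwise. *)
Definition polygon (n : nat) : seq nat :=
  1%N :: [seq j <- iota 2 n.-1 | ~~ odd j]
      ++ rev [seq j <- iota 2 n.-1 | odd j].

(* p, q, r occur in this counterclockwise cyclic order, equivalently r lies to
   the left of the segment oriented from p to q. *)
Definition ccw (n p q r : nat) : bool :=
  let x := index p (polygon n) in
  let y := index q (polygon n) in
  let z := index r (polygon n) in
  [|| (x < y < z)%N, (y < z < x)%N | (z < x < y)%N].

(* Arcs and triangles are given by their sets of vertices, and an orientation
   by the initial vertex (tail) of each arc; the values of tail and lam outside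
   the arcs of the triangulation, and of mu outside its triangles, are junk. *)
Record decorated (R : realType) (A : superAlgebra R) := Decorated {
  triangles : {fset {fset nat}};
  tail : {fset nat} -> nat;
  lam : {fset nat} -> A;
  mu : {fset nat} -> A
}.

Section Flip.
Variables (R : realType) (A : superAlgebra R) (n : nat).
Implicit Type D : decorated A.

Definition left_apex D (p r : nat) : nat :=
  head 0%N [seq v <- iota 1 n | ([fset p; r; v] \in triangles D) && ccw n p r v].

Definition right_apex D (p r : nat) : nat :=
  head 0%N [seq v <- iota 1 n | ([fset p; r; v] \in triangles D) && ccw n r p v].

(* Super Ptolemy flip of the diagonal with endpoints x and y, oriented P -> r;
   the quadrilateral is P, Q, r, S in counterclockwise order. *)
Definition flip (x y : nat) D : decorated A :=
  let P := tail D [fset x; y] in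
  let r := if P == x then y else x in
  let S := left_apex D P r in
  let Q := right_apex D P r in
  let a := lam D [fset P; S] in
  let b := lam D [fset S; r] in
  let c := lam D [fset r; Q] in
  let d := lam D [fset Q; P] in
  let e := lam D [fset P; r] in
  let theta := mu D [fset P; r; S] in
  let sigma := mu D [fset P; Q; r] in
  let f := (a * c + b * d + ssqrt (a * b * c * d) * (sigma * theta)) / e in
  let theta' := (theta * ssqrt (b * d) + sigma * ssqrt (a * c))
                  / ssqrt (a * c + b * d) in
  let sigma' := (sigma * ssqrt (b * d) - theta * ssqrt (a * c))
                  / ssqrt (a * c + b * d) in
  {| triangles := [fset Q; S; P] |` ([fset Q; r; S] |`
       (triangles D `\ [fset P; r; S] `\ [fset P; Q; r]));
     tail := fun z => if z == [fset Q; S] then Q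
                      else if z == [fset S; r]
                           then (if tail D z == S then r else S)
                      else tail D z;
     lam := fun z => if z == [fset Q; S] then f else lam D z;
     mu := fun z => if z == [fset Q; S; P] then theta'
                    else if z == [fset Q; r; S] then sigma'
                    else mu D z |}.

(* Successive flips of (n-2,n-1), (n-3,n-2), ..., (k+1,k+2). *)
Definition flips (k : nat) D : decorated A :=
  foldl (fun D' j => flip j j.+1 D') D (rev (iota k.+1 (n - 2 - k))).

End Flip.

Definition zigzag (n : nat) : {fset {fset nat}} :=
  [fset [fset j; j.+1; j.+2] | j in iota 1 (n - 2)].

Definition zigzag_arc (n : nat) (z : {fset nat}) : Prop :=
  exists p q j : nat, [/\ (1 <= j <= n - 2)%N, p \in [:: j; j.+1; j.+2],
    q \in [:: j; j.+1; j.+2], p <> q & z = [fset p; q]].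

Record initial_zigzag (R : realType) (A : superAlgebra R) (n : nat)
    (D : decorated A) : Prop := InitialZigzag {
  initial_triangles : triangles D = zigzag n;
  initial_tail : forall z, zigzag_arc n z -> tail D z \in z;
  initial_diagonal : forall j : nat, (2 <= j <= n - 2)%N ->
    tail D [fset j; j.+1] = j;
  initial_lam : forall z, zigzag_arc n z -> even_pos (lam D z);
  initial_mu : forall j : nat, (1 <= j <= n - 2)%N ->
    mu D [fset j; j.+1; j.+2] \in odd_part A
}.

(* Vertices of the auxiliary graph: [inl p] is the vertex p of the polygon and
   [inr j] is the new vertex theta_j inside the triangle (j,j+1,j+2). *)
Definition gvertex : Type := (nat + nat)%type.

(* [Arc p q] with p < q is the arc (p,q), [Sigma j] is sigma_j and [Tau j l]
   with j < l is tau_jl. *)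
Inductive gedge := Arc of nat & nat | Sigma of nat | Tau of nat & nat.

Definition gedge_code (e : gedge) : (nat * nat) + (nat + nat * nat) :=
  match e with
  | Arc p q => inl (p, q)
  | Sigma j => inr (inl j)
  | Tau j l => inr (inr (j, l))
  end.

Definition gedge_decode (c : (nat * nat) + (nat + nat * nat)) : gedge :=
  match c with
  | inl (p, q) => Arc p q
  | inr (inl j) => Sigma j
  | inr (inr (j, l)) => Tau j l
  end.

Lemma gedge_codeK : cancel gedge_code gedge_decode.
Proof. by case. Qed.

HB.instance Definition _ := Countable.copy gedge (can_type gedge_codeK).

Definition ends (e : gedge) : gvertex * gvertex :=
  match e with
  | Arc p q => (inl p, inl q)
  | Sigma j => (inr j, inl j.+1)
  | Tau j l => (inr j, inr l)
  end.

Definition joins (e : gedge) (u v : gvertex) : bool :=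
  (ends e == (u, v)) || (ends e == (v, u)).

Definition is_sigma (e : gedge) : bool := if e is Sigma _ then true else false.
Definition is_tau (e : gedge) : bool := if e is Tau _ _ then true else false.

(* Edges of the auxiliary graph of the sub-polygon formed by the triangles
   (j,j+1,j+2), i <= j <= n-2. *)
Definition is_edge (n i : nat) (e : gedge) : Prop :=
  match e with
  | Arc p q => (p < q)%N /\
      exists j, [/\ (i <= j <= n - 2)%N, p \in [:: j; j.+1; j.+2]
                  & q \in [:: j; j.+1; j.+2]]
  | Sigma j => (i <= j <= n - 2)%N
  | Tau j l => [/\ (i <= j)%N, (j < l)%N & (l <= n - 2)%N]
  end.

(* Twice the position at which an edge crosses (i,n), so 2j+1 for the diagonal
   (j+1,j+2), i <= j <= n-3, and 2j for sigma_j; None if there is no crossing. *)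
Definition crossing (n i : nat) (e : gedge) : option nat :=
  match e with
  | Arc p q => if (q == p.+1) && (i <= p.-1 <= n - 3)%N && (0 < p)%N
               then Some (p.-1.*2.+1) else None
  | Sigma j => Some j.*2
  | Tau _ _ => None
  end.

(* A path (a_0, ..., a_l | t_1, ..., t_l); the edge t_s is item s-1 of its
   second component. *)
Definition gpath : Type := (seq gvertex * seq gedge)%type.

Definition step (t : gpath) (s : nat) : gedge := nth (Arc 0 0) t.2 s.-1.

Record super_Tpath (n i : nat) (t : gpath) : Prop := SuperTpath {
  tp_size : size t.1 = (size t.2).+1;
  tp_start : nth (inl 0%N) t.1 0 = inl i;
  tp_end : nth (inl 0%N) t.1 (size t.2) = inl n;
  tp_edge : forall s, (1 <= s <= size t.2)%N -> is_edge n i (step t s);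
  tp_joins : forall s, (1 <= s <= size t.2)%N ->
    joins (step t s) (nth (inl 0%N) t.1 s.-1) (nth (inl 0%N) t.1 s);
  tp_uniq : uniq t.2;
  tp_odd : odd (size t.2);
  tp_cross : forall s, (1 <= s <= size t.2)%N -> ~~ odd s ->
    crossing n i (step t s) <> None;
  tp_sigma : forall s, (1 <= s <= size t.2)%N -> is_sigma (step t s) -> ~~ odd s;
  tp_tau : forall s, (1 <= s <= size t.2)%N -> is_tau (step t s) -> odd s;
  tp_increasing : sorted ltn (pmap (crossing n i) t.2)
}.

Definition Tpaths (n i : nat) : set gpath :=
  if (i == n - 2)%N || (i == n - 1)%N
  then [set ([:: inl i; inl n], [:: Arc i n])]
  else [set t | super_Tpath n i t].

(* theta_j > theta_l in the positive ordering. *)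
Definition pos_gt (n j l : nat) : bool :=
  if (j < l)%N then ccw n j.+2 j.+1 j
  else if (l < j)%N then ~~ ccw n l.+2 l.+1 l
  else false.

Section Weights.
Variables (R : realType) (A : superAlgebra R) (n : nat) (D : decorated A).

Definition wt_sigma (j : nat) : A :=
  ssqrt (lam D [fset j; j.+2] / (lam D [fset j; j.+1] * lam D [fset j.+1; j.+2]))
    * mu D [fset j; j.+1; j.+2].

Definition wt_arc (s : nat) (e : gedge) : A :=
  if e is Arc p q
  then (if odd s then lam D [fset p; q] else (lam D [fset p; q])^-1)
  else 1.

Definition sigma_indices (t : gpath) : seq nat :=
  pmap (fun e => if e is Sigma j then Some j else None) t.2.

Definition wt (t : gpath) : A :=
  (\prod_(1 <= s < (size t.2).+1) wt_arc s (step t s)) *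
  \prod_(j <- sort (fun j l => (j == l) || pos_gt n j l) (sigma_indices t))
     wt_sigma j.

End Weights.

(* Main.v *)
Require Import Defs.
From HB Require Import structures.
From mathcomp Require Import all_boot all_order all_algebra.
From mathcomp Require Import finmap.
From mathcomp Require Import boolp classical_sets fsbigop reals.
From mathcomp Require Import zify ring.

Set Implicit Arguments.
Unset Strict Implicit.
Unset Printing Implicit Defensive.

Import Order.TTheory GRing.Theory Num.Theory.

Local Open Scope classical_set_scope.
Local Open Scope fset_scope.
Local Open Scope ring_scope.

(** Write x_j, y_j for the initial lambda-lengths of (j,j+1) and (j,j+2), X_j for
    that of (j,n) after the flips, w_j for the weight of sigma_j, and B_j for the
    left-hand side of (a).  The product of the two mu-invariants of the
    quadrilateral annihilates the new mu-invariant, so under the square root in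
    B_k the nilpotent correction of X_k can be dropped, and the flip of
    (k+1,k+2) becomes
      B_k = B_{k+1} + X_{k+1} w_k,
      X_k = (x_k X_{k+2} + y_k X_{k+1}) / x_{k+1} + x_k {B_{k+1}, w_k},
    where the braces stand for the product of the two factors in the positive
    order.  On the other side, a super T-path from k starts with (k,k+1),(k+1,k+2)
    followed by a path from k+2; or with (k,k+1), sigma_k, tau_{kl}, sigma_l
    followed by a path from l+1; or it comes from a path from k+1 by prepending
    (k,k+2),(k+2,k+1) and cancelling (k+1,k+2) when it is thereby repeated.
    Hence the sums of weights obey the same recursion. *)

(** * Supercommutative algebra *)

Section SuperAlgebraTheory.
Variables (R : realType) (A : superAlgebra R).
Implicit Types x y z u v : A.
Local Notation ev := (even_part A).
Local Notation od := (odd_part A).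
Local Notation bd := (body A).

Lemma evenD x y : x \in ev -> y \in ev -> x + y \in ev.
Proof.
by move=> hx hy; rewrite -[x]scale1r; case: (even_submod A) => _; apply.
Qed.

Lemma evenZ (c : R) x : x \in ev -> c *: x \in ev.
Proof.
by move=> hx; rewrite -[_ *: _]addr0; case: (even_submod A) => h0; apply.
Qed.

Lemma evenN x : x \in ev -> - x \in ev.
Proof. by move=> hx; rewrite -scaleN1r evenZ. Qed.

Lemma evenB x y : x \in ev -> y \in ev -> x - y \in ev.
Proof. by move=> hx hy; rewrite evenD ?evenN. Qed.

Lemma evenA (c : R) : c%:A \in ev.
Proof. by rewrite evenZ ?even_one. Qed.

Lemma odd_partD x y : x \in od -> y \in od -> x + y \in od.
Proof.
by move=> hx hy; rewrite -[x]scale1r; case: (odd_submod A) => _; apply.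
Qed.

Lemma odd_mul_even x y : x \in od -> y \in ev -> x * y \in od.
Proof. by move=> hx hy; rewrite -(even_central _ hy) even_mul_odd. Qed.

Lemma odd_sqr x : x \in od -> x * x = 0.
Proof.
move=> hx; have /eqP := odd_anticomm hx hx; rewrite -addr_eq0 -mulr2n => /eqP h.
have : (2%:R : R)^-1 *: ((x * x) *+ 2) = 0 by rewrite h scaler0.
by rewrite -scaler_nat scalerA mulVf ?scale1r // pnatr_eq0.
Qed.

Lemma body_odd x : x \in od -> bd x = 0.
Proof.
move=> /odd_sqr /(congr1 bd); rewrite rmorphM rmorph0 => /eqP.
by rewrite mulf_eq0 orbb => /eqP.
Qed.

Lemma body_nil x m : x ^+ m = 0 -> bd x = 0.
Proof.
move=> /(congr1 bd); rewrite rmorphXn rmorph0 => /eqP.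
by rewrite expf_eq0 => /andP[_ /eqP].
Qed.

(** With [c] the body of [x], the element [1 - c^-1 x] has body 0, hence is nilpotent, and a finite
    geometric series inverts [c^-1 x]. *)
Lemma body_unit x : bd x != 0 -> x \is a GRing.unit.
Proof.
move=> hx; set c := bd x.
pose e := 1 - c^-1 *: x.
have /soul_nil[m hm] : bd e = 0.
  rewrite /e rmorphB rmorph1 -mulr_algl rmorphM body_scalar.
  by rewrite mulVf // subrr.
have : 1 - e \is a GRing.unit.
  have h : (1 - e) * (\sum_(i < m) e ^+ i) = 1.
    by rewrite -[1 - e]opprB mulNr -subrX1 hm sub0r opprK.
  apply/unitrP; exists (\sum_(i < m) e ^+ i); split=> //.
  rewrite -[RHS]h; apply/esym/commr_sum => i _.
  by apply: commrX; apply/commr_sym/commrB => //; apply: commr1.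
by rewrite /e opprB addrC subrK scaler_unit // unitfE invr_eq0.
Qed.

(** The odd part [v] of the inverse satisfies [x v = 1 - x u], which is both odd and even; so it
    vanishes, and [v] with it. *)
Lemma even_inv x : x \in ev -> x^-1 \in ev.
Proof.
have [ux hx|] := boolP (x \is a GRing.unit); last by move/invr_out->.
have [u [v [hu hv e]]] := even_odd_sum x^-1.
have xv0 : x * v = 0.
  apply: even_odd_direct; last by rewrite even_mul_odd.
  have -> : x * v = 1 - x * u by rewrite -(mulrV ux) e mulrDr addrC addKr.
  by rewrite evenB ?even_one ?even_mul_even.
by rewrite e -[v](mulKr ux) xv0 mulr0 addr0.
Qed.

Lemma even_posM x y : even_pos x -> even_pos y -> even_pos (x * y).
Proof.
by move=> [hx px] [hy py]; split; [rewrite even_mul_even|rewrite rmorphM mulr_gt0].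
Qed.

Lemma even_posD x y : even_pos x -> even_pos y -> even_pos (x + y).
Proof. by move=> [hx px] [hy py]; split; [rewrite evenD|rewrite rmorphD addr_gt0]. Qed.

Lemma even_pos_unit x : even_pos x -> x \is a GRing.unit.
Proof. by move=> [_ px]; rewrite body_unit // gt_eqF. Qed.

Lemma even_posV x : even_pos x -> even_pos x^-1.
Proof.
move=> hx; have [ex px] := hx; split; first exact: even_inv.
by rewrite rmorphV ?even_pos_unit // invr_gt0.
Qed.

Lemma even_pos_div x y : even_pos x -> even_pos y -> even_pos (x / y).
Proof. by move=> hx hy; apply: even_posM => //; apply: even_posV. Qed.

(** The sum [y + z] has positive body, so it is a unit and can be cancelled from
    [(y - z) (y + z) = 0]. *)
Lemma even_pos_sqr_inj y z : even_pos y -> even_pos z -> y ^+ 2 = z ^+ 2 -> y = z.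
Proof.
move=> hy hz e; have /even_pos_unit u := even_posD hy hz.
apply/eqP; rewrite -subr_eq0 -[_ - _](mulrK u); apply/eqP.
have -> : (y - z) * (y + z) = 0; last by rewrite mul0r.
have c : y * z = z * y by apply: even_central; case: hy.
by rewrite mulrDr !mulrBl -!expr2 e c addrC subrKA subrr.
Qed.

(* Newton's iteration: each step squares the nilpotent error. *)
Lemma even_pos_sqrt_newton m x y : even_pos x -> even_pos y -> (y ^+ 2 - x) ^+ m = 0 ->
  exists z, even_pos z /\ z ^+ 2 = x.
Proof.
elim/ltn_ind: m y => m IH y hx hy.
have [m1 h|m2 h] := leqP m 1.
  exists y; split=> //; apply/eqP; rewrite -subr_eq0; apply/eqP.
  by case: m m1 {IH} h => [|[|]] // _; rewrite ?expr1 // expr0 => /eqP; rewrite oner_eq0.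
set e := y ^+ 2 - x in h *; have ee : e \in ev.
  by rewrite evenB //; [rewrite expr2 even_mul_even //; case: hy|case: hx].
pose i2y := (2%:R : R)^-1 *: y^-1.
have uy := even_pos_unit hy.
have ei : i2y \in ev by rewrite evenZ // even_inv //; case: hy.
have ey : y * i2y *+ 2 = 1.
  by rewrite /i2y -scalerAr mulrV // -scaler_nat scalerA mulfV ?scale1r // pnatr_eq0.
have ney : (y - e * i2y) ^+ 2 - x = (e * i2y) ^+ 2.
  have cE : e * i2y * y = y * (e * i2y) by apply: even_central; apply: even_mul_even.
  have : y ^+ 2 - x = y * (e * i2y) + y * (e * i2y).
    by rewrite -/e -[LHS]mulr1 -ey -mulr2n mulrnAr !mulrA (even_central y ee).
  move: cE; set E := e * i2y => cE /eqP; rewrite subr_eq => /eqP e2.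
  clearbody E; rewrite expr2 mulrBr !mulrBl -!expr2 cE e2.
  by rewrite [_ + x]addrAC addrK addrAC addrK opprB addrC subrK.
(* The new error is the square of [e * i2y], so its power [uphalf m] contains the factor [e ^+ m];
   for [m >= 2] this exponent is smaller than [m]. *)
apply: (IH (uphalf m)) (y - e * i2y) _ _ _ => //.
- lia.
- split; first by rewrite evenB ?even_mul_even //; case: hy.
  by rewrite rmorphB rmorphM (body_nil h) mul0r subr0; case: hy.
- rewrite ney -exprM exprMn_comm; last by apply: even_central.
  have -> : (2 * uphalf m = m + (2 * uphalf m - m))%N by lia.
  by rewrite exprD h !mul0r.
Qed.

(** Newton's iteration starts at the real square root of the body: its square differs from [x] by an
    element of body 0, which is nilpotent. *)
Lemma ssqrt_spec x : even_pos x -> even_pos (ssqrt x) /\ ssqrt x ^+ 2 = x.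
Proof.
move=> hx; have [ex px] := hx.
have [z hz] : exists z, even_pos z /\ z ^+ 2 = x.
  have bs : bd ((Num.sqrt (bd x))%:A) = Num.sqrt (bd x) by rewrite body_scalar.
  have [m hm] : exists m, ((Num.sqrt (bd x))%:A ^+ 2 - x) ^+ m = 0.
    by apply: soul_nil; rewrite rmorphB rmorphXn /= bs sqr_sqrtr ?subrr // ltW.
  apply: even_pos_sqrt_newton hm => //; split; first exact: evenA.
  by rewrite bs sqrtr_gt0.
exact: (@xgetPex _ 0 [set y : A | even_pos y /\ y ^+ 2 = x] (ex_intro _ z hz)).
Qed.

Lemma ssqrt_pos x : even_pos x -> even_pos (ssqrt x).
Proof. by case/ssqrt_spec. Qed.

Lemma ssqrt_sqr x : even_pos x -> ssqrt x ^+ 2 = x.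
Proof. by case/ssqrt_spec. Qed.

Lemma ssqrt_unique x y : even_pos y -> y ^+ 2 = x -> ssqrt x = y.
Proof.
move=> hy <-; have hx : even_pos (y ^+ 2) by rewrite expr2; apply: even_posM.
by apply: even_pos_sqr_inj (ssqrt_pos hx) hy (ssqrt_sqr hx).
Qed.

Lemma ssqrtM x y : even_pos x -> even_pos y -> ssqrt (x * y) = ssqrt x * ssqrt y.
Proof.
move=> hx hy; have [sx ex] := ssqrt_spec hx; have [sy ey] := ssqrt_spec hy.
apply: ssqrt_unique; first exact: even_posM.
by rewrite exprMn_comm ?ex ?ey //; apply: even_central; case: sx.
Qed.

Lemma ssqrtV x : even_pos x -> ssqrt x^-1 = (ssqrt x)^-1.
Proof.
move=> hx; have [sx ex] := ssqrt_spec hx.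
by apply: ssqrt_unique; [exact: even_posV|rewrite exprVn ex].
Qed.

End SuperAlgebraTheory.

(** * The even subring and square-root identities for one flip *)

Section EvenRing.
Variables (R : realType) (A : superAlgebra R).

Fact even_subring : subring_closed (even_part A).
Proof. by split; [exact: even_one|exact: evenB|exact: even_mul_even]. Qed.

HB.instance Definition _ := GRing.isSubringClosed.Build A (even_part A) even_subring.

(* Packaged as a commutative ring only to give access to [ring]. *)
Definition even_ring : Type := {x : A | x \in even_part A}.

HB.instance Definition _ := SubChoice.on even_ring.
HB.instance Definition _ := [SubChoice_isSubNzRing of even_ring by <:].

Fact even_ring_mulC : @commutative even_ring even_ring *%R.
Proof. by move=> x y; apply: val_inj; rewrite !rmorphM /=; exact: even_central (valP x). Qed.

HB.instance Definition _ := GRing.PzRing_hasCommutativeMul.Build even_ring even_ring_mulC.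

Lemma even_lift (x : A) : x \in even_part A -> exists y : even_ring, x = \val y.
Proof. by move=> hx; exists (Sub x hx); rewrite SubK. Qed.

Lemma even_mulCA (x y z : A) : x \in even_part A -> y * (x * z) = x * (y * z).
Proof. by move=> hx; rewrite mulrA -(even_central _ hx) mulrA. Qed.

(** The sum of the two roots is a unit, and multiplying it by their difference gives [M - N]. This
    is how a nilpotent correction is dropped under a root in front of an element that it
    annihilates. *)
Lemma ssqrt_mul_eq (M N z : A) : even_pos M -> even_pos N -> (M - N) * z = 0 ->
  ssqrt M * z = ssqrt N * z.
Proof.
move=> hM hN hz; have [sM eM] := ssqrt_spec hM; have [sN eN] := ssqrt_spec hN.
have u := even_pos_unit (even_posD sM sN).
apply/eqP; rewrite -subr_eq0 -mulrBl; apply/eqP/(mulrI u).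
have c : ssqrt N * ssqrt M = ssqrt M * ssqrt N by apply: even_central; case: sN.
rewrite mulr0 mulrA -[RHS]hz; congr (_ * z).
by rewrite mulrDl !mulrBr c addrA subrK -!expr2 eM eN.
Qed.

(** Writing lengths as squares turns identities between roots into identities between Laurent
    monomials, which [ring] settles in [even_ring]. *)
Lemma even_pos_root (x : A) : even_pos x -> exists y, even_pos y /\ x = y ^+ 2.
Proof. by move=> /ssqrt_spec[h e]; exists (ssqrt x). Qed.

Lemma ssqrtX2 (y : A) : even_pos y -> ssqrt (y ^+ 2) = y.
Proof. by move=> hy; apply: ssqrt_unique. Qed.

Lemma even_posVl (y : A) : even_pos y -> exists a b : even_ring,
  [/\ y = \val a, y^-1 = \val b & a * b = 1].
Proof.
move=> hy; have [ey _] := hy; have [a Ea] := even_lift ey.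
have [b Eb] := even_lift (even_inv ey); exists a, b; split=> //.
by apply: val_inj; rewrite rmorphM rmorph1 /= -Ea -Eb mulrV // even_pos_unit.
Qed.

Section Ptolemy.
Variables (p q r u v : A).
Hypotheses (hp : even_pos p) (hq : even_pos q) (hr : even_pos r)
           (hu : even_pos u) (hv : even_pos v).

(** In the flip of (k+1,k+2) the variables [p q r u v] are x_k, x_{k+1}, y_k, X_{k+1}, X_{k+2}. The
    two roots on the right are the even factors of B_{k+1} and of w_k. *)
Lemma ptolemy_sqrt :
  ssqrt (p * r * v * u) / q = p * (ssqrt (u * v / q) * ssqrt (r / (p * q))).
Proof.
have [P [hP Ep]] := even_pos_root hp; have [Q [hQ Eq]] := even_pos_root hq.
have [S [hS Er]] := even_pos_root hr; have [U [hU Eu]] := even_pos_root hu.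
have [V [hV Ev]] := even_pos_root hv.
have -> : ssqrt (p * r * v * u) = P * S * V * U.
  rewrite !ssqrtM; do ?[apply: even_posM] => //.
  by rewrite Ep Er Ev Eu !ssqrtX2.
have -> : ssqrt (u * v / q) = U * V / Q.
  rewrite !ssqrtM ?ssqrtV; do ?[apply: even_posM|apply: even_posV] => //.
  by rewrite Eq Ev Eu !ssqrtX2.
have -> : ssqrt (r / (p * q)) = S / (P * Q).
  rewrite ssqrtM ?ssqrtV ?ssqrtM; do ?[apply: even_posM|apply: even_posV] => //.
  by rewrite Eq Ep Er !ssqrtX2.
rewrite Ep Eq [(P * Q)^-1]invrM ?even_pos_unit // -exprVn.
have [a [a' [-> -> Ea]]] := even_posVl hP; have [b [b' [_ -> _]]] := even_posVl hQ.
have [/even_lift[c ->] _] := hS; have [/even_lift[d ->] _] := hU.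
have [/even_lift[e ->] _] := hV.
rewrite -!rmorphXn -!rmorphM; congr (\val _); ring: Ea.
Qed.

(** Covers the case n = k+2 of the formula for B_k, where X_k = y_k and X_{k+1} = x_{k+1}. *)
Lemma ptolemy_base : ssqrt (r * q / p) = q * ssqrt (r / (p * q)).
Proof.
have [P [hP Ep]] := even_pos_root hp; have [Q [hQ Eq]] := even_pos_root hq.
have [S [hS Er]] := even_pos_root hr.
have -> : ssqrt (r * q / p) = S * Q / P.
  rewrite !ssqrtM ?ssqrtV; do ?[apply: even_posM|apply: even_posV] => //.
  by rewrite Ep Eq Er !ssqrtX2.
have -> : ssqrt (r / (p * q)) = S / (P * Q).
  rewrite ssqrtM ?ssqrtV ?ssqrtM; do ?[apply: even_posM|apply: even_posV] => //.
  by rewrite Eq Ep Er !ssqrtX2.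
rewrite Eq [(P * Q)^-1]invrM ?even_pos_unit //.
have [? [? [_ -> _]]] := even_posVl hP; have [? [? [-> -> Eb]]] := even_posVl hQ.
have [/even_lift[? ->] _] := hS.
by rewrite -!rmorphXn -!rmorphM; congr (\val _); ring: Eb.
Qed.

(** Here [M] is x_{k+1} X_k with its nilpotent term. Since that term kills [th] and [be], the root
    of [M] acts on the numerator of the new mu-invariant like the root of [p * v + r * u], and the
    latter cancels the denominator. *)
Lemma ptolemy_box (M th be : A) : even_pos M ->
  (M - (p * v + r * u)) * th = 0 -> (M - (p * v + r * u)) * be = 0 ->
  ssqrt (M / q * u / p)
    * ((th * ssqrt (r * u) + be * ssqrt (p * v)) / ssqrt (p * v + r * u))
  = ssqrt (u * v / q) * be + u * (ssqrt (r / (p * q)) * th).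
Proof.
move=> hM Mth Mbe; have hN := even_posD (even_posM hp hv) (even_posM hr hu).
have [P [hP Ep]] := even_pos_root hp; have [Q [hQ Eq]] := even_pos_root hq.
have [S [hS Er]] := even_pos_root hr; have [U [hU Eu]] := even_pos_root hu.
have [V [hV Ev]] := even_pos_root hv.
have sM := ssqrt_pos hM; have sN := ssqrt_pos hN.
have -> : ssqrt (M / q * u / p) = ssqrt M / Q * U / P.
  rewrite !ssqrtM ?ssqrtV; do ?[apply: even_posM|apply: even_posV] => //.
  by rewrite Ep Eq Eu !ssqrtX2.
have -> : ssqrt (u * v / q) = U * V / Q.
  rewrite !ssqrtM ?ssqrtV; do ?[apply: even_posM|apply: even_posV] => //.
  by rewrite Eq Ev Eu !ssqrtX2.
have -> : ssqrt (r / (p * q)) = S / (P * Q).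
  rewrite ssqrtM ?ssqrtV ?ssqrtM; do ?[apply: even_posM|apply: even_posV] => //.
  by rewrite Eq Ep Er !ssqrtX2.
have -> : ssqrt (r * u) = S * U by rewrite ssqrtM // Er Eu !ssqrtX2.
have -> : ssqrt (p * v) = P * V by rewrite ssqrtM // Ep Ev !ssqrtX2.
have [eS _] := hS; have [eU _] := hU; have [eP _] := hP; have [eV _] := hV.
rewrite -(even_central th (even_mul_even eS eU)) -(even_central be (even_mul_even eP eV)).
set z := _ * th + _.
have Ez : ssqrt M * z = ssqrt (p * v + r * u) * z.
  apply: ssqrt_mul_eq => //; rewrite mulrDr !(even_mulCA _ _ (even_mul_even _ _)) //.
  by rewrite Mth Mbe !mulr0 addr0.
have -> : ssqrt M / Q * U / P * (z / ssqrt (p * v + r * u)) = U / (P * Q) * z.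
  have [sM1 _] := sM; have [sN1 _] := sN.
  rewrite -(even_central z (even_inv sN1)).
  have -> : ssqrt M / Q * U / P = U / (P * Q) * ssqrt M.
    rewrite [(P * Q)^-1]invrM ?even_pos_unit //.
    have [? [? [_ -> _]]] := even_posVl hP; have [? [? [_ -> _]]] := even_posVl hQ.
    have [/even_lift[? ->] /even_lift[? ->]] := (eU, sM1).
    by rewrite -!rmorphM; congr (\val _); ring.
  by rewrite -mulrA (even_mulCA _ _ (even_inv sN1)) Ez mulKr // even_pos_unit.
rewrite /z mulrDr addrC Eu [(P * Q)^-1]invrM ?even_pos_unit // !mulrA.
have [a [a' [-> -> Ea]]] := even_posVl hP; have [b [b' [_ -> _]]] := even_posVl hQ.
have [/even_lift[c ->] /even_lift[d ->]] := (eS, eU); have [e ->] := even_lift eV.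
by congr (_ * be + _ * th); rewrite -?rmorphXn -!rmorphM; congr (\val _); ring: Ea.
Qed.

End Ptolemy.
End EvenRing.

(** * Vertex order and flips *)

Section PolygonOrder.
Variable n : nat.
Local Open Scope nat_scope.

(** Increases along the counterclockwise list: the odd labels from 3 on are reflected to values
    above [n]. Orientation tests thereby become arithmetic. *)
Definition rank v := if v == 1 then 0 else if odd v then n.*2.+2 - v else v.

Lemma mem_polygon v : 0 < v <= n -> v \in polygon n.
Proof.
move=> hv; rewrite /polygon inE mem_cat mem_rev !mem_filter mem_iota.
by case: eqP => //= hv1; case: (odd v) => /=; lia.
Qed.

Lemma polygon_sorted : sorted (relpre rank ltn) (polygon n).
Proof.
have h : pairwise ltn (iota 2 n.-1).
  by rewrite -sorted_pairwise ?iota_ltn_sorted //; exact: ltn_trans.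
apply: pairwise_sorted; rewrite /polygon pairwise_cons pairwise_cat.
apply/and4P; split.
- apply/allP => v; rewrite mem_cat mem_rev !mem_filter mem_iota /= /rank.
  by rewrite /=; case: eqP; case: (odd v) => /=; lia.
- apply/allrelP => v w; rewrite mem_rev !mem_filter !mem_iota /= /rank.
  by do 2 case: eqP; case: (odd v); case: (odd w) => /=; lia.
- apply: (@sub_in_pairwise _ [pred v | (~~ odd v) && (1 < v <= n)]) (pairwise_filter _ h).
    by move=> v w; rewrite !inE /= /rank; do 2 case: eqP; case: (odd v); case: (odd w) => /=; lia.
  by apply/allP => v; rewrite mem_filter mem_iota inE; lia.
- rewrite -sorted_pairwise; last by move=> ? ? ? /=; lia.
  rewrite rev_sorted; apply: pairwise_sorted.
  apply: (@sub_in_pairwise _ [pred v | (odd v) && (1 < v <= n)]) (pairwise_filter _ h).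
    by move=> v w; rewrite !inE /= /rank; do 2 case: eqP; case: (odd v); case: (odd w) => /=; lia.
  by apply/allP => v; rewrite mem_filter mem_iota inE; lia.
Qed.

Lemma index_polygon v w : 0 < v <= n -> 0 < w <= n ->
  (index v (polygon n) < index w (polygon n)) = (rank v < rank w).
Proof.
move=> hv hw; have pv := mem_polygon hv; have pw := mem_polygon hw.
have tr : transitive (relpre rank ltn) by move=> ? ? ? /=; lia.
apply/idP/idP; first exact: (sorted_ltn_index tr polygon_sorted).
move=> h; rewrite ltnNge; apply/negP; rewrite leq_eqVlt => /orP[/eqP E|].
  by move: h; rewrite -(nth_index 0 pv) -E nth_index // ltnn.
by move/(sorted_ltn_index tr polygon_sorted _ _ pw pv) => /=; lia.
Qed.

Lemma ccw_rank p q r : 0 < p <= n -> 0 < q <= n -> 0 < r <= n ->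
  ccw n p q r = [|| rank p < rank q < rank r, rank q < rank r < rank p
                  | rank r < rank p < rank q].
Proof. by move=> hp hq hr; rewrite /ccw !index_polygon. Qed.

Lemma ccw_neq p q r : ccw n p q r -> (r != p) && (r != q).
Proof.
by rewrite /ccw; case: eqP => [->|_]; case: eqP => [->|_] //=; lia.
Qed.

(** Consecutive labels from 2 on lie on opposite chains of the polygon, so parity tells the
    direction in which the diagonal crosses and hence on which side the smaller labels lie. *)
Lemma ccw_prev j : 1 < j < n ->
  ccw n j j.+1 j.-1 = ~~ odd j /\ ccw n j.+1 j j.-1 = odd j.
Proof.
move=> hj; rewrite !ccw_rank /rank; try lia.
case: j hj => [|[|[|j]]] //= hj; first by split; lia.
by case: (odd j) => /=; split; lia.
Qed.

Lemma ccw_last j : 1 < j -> j.+1 < n ->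
  ccw n j j.+1 n = odd j /\ ccw n j.+1 j n = ~~ odd j.
Proof.
move=> hj hn; rewrite !ccw_rank; try lia.
have n1 : (n == 1) = false by lia.
have j1 : (j == 1) = false by lia.
rewrite /rank n1 j1 /= -[j.+1 == 1]/(j == 0) (_ : (j == 0) = false); last lia.
by case: (odd j); case: (odd n) => /=; split; lia.
Qed.

End PolygonOrder.

Lemma fset2_eq (a b c d : nat) :
  ([fset a; b] == [fset c; d]) = ((a == c) && (b == d)) || ((a == d) && (b == c)).
Proof.
rewrite eqEfsubset !fsubUset !fsub1set !inE (eq_sym c) (eq_sym d) (eq_sym c) (eq_sym d).
by case: (a == c); case: (a == d); case: (b == c); case: (b == d).
Qed.

Lemma fset3_eq (a b c d e f : nat) :
  ([fset a; b; c] == [fset d; e; f]) =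
  [&& a \in [:: d; e; f], b \in [:: d; e; f], c \in [:: d; e; f],
      d \in [:: a; b; c], e \in [:: a; b; c] & f \in [:: a; b; c]].
Proof.
by rewrite eqEfsubset !fsubUset !fsub1set !inE -!andbA !orbA.
Qed.

(** * The triangulation along the sequence of flips *)

Section FlipSequence.
Variables (R : realType) (A : superAlgebra R) (n : nat) (D0 : decorated A).
Implicit Type D : decorated A.

(* Holds after the flip that creates the arc (k,n). *)
Record fan_state (k : nat) D : Prop := FanState {
  fan_triangles : forall z, z \in triangles D ->
    [\/ exists2 j, (0 < j < k)%N & z = [fset j; j.+1; j.+2],
        z = [fset k; k.+1; n]
      | exists2 m, (k <= m <= n - 3)%N & z = [fset m; m.+2; n]];
  fan_old : forall j, (0 < j < k)%N -> [fset j; j.+1; j.+2] \in triangles D;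
  fan_new : [fset k; k.+1; n] \in triangles D;
  fan_tail : forall j, (1 < j <= k)%N -> tail D [fset j; j.+1] = j;
  fan_lam : forall p q, (p < q < n)%N || (q == n) && (n - 2 <= p < n)%N ->
    lam D [fset p; q] = lam D0 [fset p; q];
  fan_mu : forall j, (0 < j < k)%N ->
    mu D [fset j; j.+1; j.+2] = mu D0 [fset j; j.+1; j.+2]
}.

Lemma head_filter (a : pred nat) (x : nat) : (0 < x <= n)%N ->
  a x -> (forall v, (0 < v <= n)%N -> a v -> v = x) ->
  head 0%N [seq v <- iota 1 n | a v] = x.
Proof.
move=> hx ax ha; rewrite (@eq_in_filter _ a (pred1 x)).
  by rewrite filter_pred1_uniq ?iota_uniq // mem_iota; lia.
move=> v; rewrite mem_iota => hv /=; apply/idP/eqP => [|->//]; apply: ha; lia.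
Qed.

(** In a fan state the only triangles on the arc (k+1,k+2) are Delta_k and (k+1,k+2,n); parity
    decides which of them lies to the left. *)
Lemma fan_apex k D : (0 < k)%N -> (k.+3 <= n)%N -> fan_state k.+1 D ->
  left_apex n D k.+1 k.+2 = (if odd k then k else n) /\
  right_apex n D k.+1 k.+2 = (if odd k then n else k).
Proof.
move=> k0 hk hD.
have [/= ec1 ec2] := ccw_prev (n := n) (j := k.+1) ltac:(lia).
have [/= el1 el2] := ccw_last (n := n) (j := k.+1) ltac:(lia) ltac:(lia).
have tk : [fset k.+1; k.+2; k] \in triangles D.
  rewrite (_ : [fset _; _; _] = [fset k; k.+1; k.+2]); first by apply: fan_old hD _ _; lia.
  by apply/eqP; rewrite fset3_eq !inE; lia.
have tn := fan_new hD.
have apex v : [fset k.+1; k.+2; v] \in triangles D -> v != k.+1 -> v != k.+2 -> v = k \/ v = n.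
  move=> /(fan_triangles hD)[[j hj]|/eqP|[m hm]] + n1 n2; [move/eqP| |move/eqP];
  rewrite fset3_eq !inE; lia.
split; apply: head_filter.
- by case: ifP; lia.
- by case: ifP => ok; rewrite ?tk ?tn ?ec1 ?el1 /=; move: ok; case: (odd k).
- move=> v hv /andP[/apex h ccv]; have /andP[n1 n2] := ccw_neq ccv.
  case: (h n1 n2) ccv => ->; rewrite ?ec1 ?el1; by case: (odd k).
- by case: ifP; lia.
- by case: ifP => ok; rewrite ?tk ?tn ?ec2 ?el2 /=; move: ok; case: (odd k).
- move=> v hv /andP[/apex h ccv]; have /andP[n1 n2] := ccw_neq ccv.
  case: (h n2 n1) ccv => ->; rewrite ?ec2 ?el2; by case: (odd k).
Qed.

(** The hypotheses on [D'] do not say which apex is on the left, so both parities reduce to this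
    statement. *)
Lemma fan_step k D D' : (0 < k)%N -> (k.+3 <= n)%N -> fan_state k.+1 D ->
  (forall z, z \in triangles D' = [|| z == [fset k; k.+1; n], z == [fset k; k.+2; n]
     | [&& z != [fset k; k.+1; k.+2], z != [fset k.+1; k.+2; n] & z \in triangles D]]) ->
  (forall j, (1 < j <= k)%N -> tail D' [fset j; j.+1] = tail D [fset j; j.+1]) ->
  (forall z, z != [fset k; n] -> lam D' z = lam D z) ->
  (forall z, z != [fset k; k.+1; n] -> z != [fset k; k.+2; n] -> mu D' z = mu D z) ->
  fan_state k D'.
Proof.
move=> k0 hk hD ht htl hl hm; split.
- move=> z; rewrite ht => /or3P[/eqP->|/eqP->|/and3P[n1 n2 /(fan_triangles hD)]].
  + by constructor 2.
  + by constructor 3; exists k => //; lia.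
  + case=> [[j hj E]|E|[m hmk E]].
    * constructor 1; exists j => //; have [Ej|] := eqVneq j k; last lia.
      by rewrite E Ej eqxx in n1.
    * by rewrite E eqxx in n2.
    * by constructor 3; exists m => //; lia.
- move=> j hj; rewrite ht (fan_old hD); last lia.
  by rewrite !fset3_eq !inE andbT; apply/or3P; constructor 3; lia.
- by rewrite ht eqxx.
- by move=> j hj; rewrite htl // (fan_tail hD) //; lia.
- by move=> p q h; rewrite hl ?(fan_lam hD) // fset2_eq; lia.
- move=> j hj; rewrite hm ?(fan_mu hD) //; [lia|rewrite fset3_eq !inE; lia|].
  by rewrite fset3_eq !inE; lia.
Qed.

Lemma fset3_perm1 (a b c : nat) : [fset a; b; c] = [fset a; c; b].
Proof. exact: fsetUAC. Qed.

Lemma fset3_perm2 (a b c : nat) : [fset a; b; c] = [fset b; a; c].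
Proof. by rewrite [[fset a; b]]fsetUC. Qed.

(** The triangle (k,k+1,n) contains the tail k+1 of the flipped diagonal whatever the parity, so it
    always receives the mu-invariant given by the formula with a plus sign; parity only exchanges
    the roles of the two old triangles. *)
Lemma flip_fan k D : (0 < k)%N -> (k.+3 <= n)%N -> fan_state k.+1 D ->
  let x := lam D0 [fset k; k.+1] in
  let y := lam D0 [fset k; k.+2] in
  let X1 := lam D [fset k.+1; n] in
  let X2 := lam D [fset k.+2; n] in
  let theta := mu D0 [fset k; k.+1; k.+2] in
  let box := mu D [fset k.+1; k.+2; n] in
  let D' := flip n k.+1 k.+2 D in
  [/\ fan_state k D',
      forall m, (k < m)%N -> (m < n)%N -> lam D' [fset m; n] = lam D [fset m; n],
      lam D' [fset k; n] =
        (if odd k then x * X2 + y * X1 + ssqrt (x * y * X2 * X1) * (box * theta)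
         else X1 * y + X2 * x + ssqrt (X1 * X2 * y * x) * (theta * box))
        / lam D0 [fset k.+1; k.+2]
    & mu D' [fset k; k.+1; n] =
        if odd k then (theta * ssqrt (y * X1) + box * ssqrt (x * X2))
            / ssqrt (x * X2 + y * X1)
        else (box * ssqrt (X2 * x) + theta * ssqrt (X1 * y))
            / ssqrt (X1 * y + X2 * x)].
Proof.
move=> k0 hk hD x y X1 X2 theta box D'.
have [eS eQ] := fan_apex k0 hk hD.
have eP := fan_tail hD (j := k.+1) ltac:(lia).
have El p q : (p < q < n)%N || (q == n) && (n - 2 <= p < n)%N ->
    lam D [fset p; q] = lam D0 [fset p; q] by apply: (fan_lam hD).
have Em := fan_mu hD (j := k) ltac:(lia).
have C2 (p q : nat) : [fset p; q] = [fset q; p] by rewrite fsetUC.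
have Ex := El k k.+1 ltac:(lia); have Ey := El k k.+2 ltac:(lia).
have Ee := El k.+1 k.+2 ltac:(lia).
have D'E : D' = flip n k.+1 k.+2 D by [].
clearbody D'; move: D'E; rewrite /flip eP eqxx eS eQ; case: (odd k) => {eS eQ}.
- rewrite [[fset n; k; k.+1]]fset3_perm2 [[fset k; n; k.+1]]fset3_perm1.
  rewrite [[fset n; k.+2; k]]fset3_perm1 [[fset n; k; k.+2]]fset3_perm2.
  rewrite [[fset k; n; k.+2]]fset3_perm1.
  rewrite [[fset k.+1; k.+2; k]]fset3_perm1 [[fset k.+1; k; k.+2]]fset3_perm2.
  rewrite [[fset k.+1; n; k.+2]]fset3_perm1.
  rewrite (C2 k.+1 k) (C2 n k) (C2 n k.+1) Ex Ey Ee Em -/x -/y -/X1 -/X2 -/theta -/box.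
  move=> D'E; rewrite D'E; split=> /=.
  + apply: (fan_step k0 hk hD) => /=.
    * by move=> z; rewrite !inE; do 2 congr (_ || _); rewrite andbCA.
    (* The new arc is (k,n) and the reversed side is (k,k+2), so the diagonals still to be flipped
       keep their tails. *)
    * by move=> j hj; rewrite !fset2_eq !ifF //; lia.
    * by move=> z /negPf->.
    * by move=> z /negPf-> /negPf->.
  + by move=> m hm1 hm2; rewrite fset2_eq ifF //; lia.
  + by rewrite eqxx.
  + by rewrite eqxx.
- rewrite [[fset k; n; k.+1]]fset3_perm1 [[fset k.+1; k; k.+2]]fset3_perm2.
  rewrite (C2 n k.+2) (C2 k.+2 k) Ex Ey Ee Em -/x -/y -/X1 -/X2 -/theta -/box.
  move=> D'E; rewrite D'E; split=> /=.
  + apply: (fan_step k0 hk hD) => /=.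
    * by move=> z; rewrite !inE.
    * by move=> j hj; rewrite !fset2_eq !ifF //; lia.
    * by move=> z /negPf->.
    * by move=> z /negPf-> /negPf->.
  + by move=> m hm1 hm2; rewrite fset2_eq ifF //; lia.
  + by rewrite eqxx.
  + by rewrite eqxx.
Qed.

Lemma flipsS k D : (k.+3 <= n)%N -> flips n k D = flip n k.+1 k.+2 (flips n k.+1 D).
Proof.
move=> hk; rewrite /flips (_ : (n - 2 - k = (n - 2 - k.+1).+1)%N); last lia.
by rewrite /= rev_cons foldl_rcons.
Qed.

Lemma flips_id k D : (n - 2 <= k)%N -> flips n k D = D.
Proof. by move=> hk; rewrite /flips (_ : (n - 2 - k = 0)%N) //; lia. Qed.

End FlipSequence.

(** * The recursion for the lengths X_k and the elements B_k *)

Section FanRecursion.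
Variables (R : realType) (A : superAlgebra R) (n : nat) (D : decorated A).
Hypothesis hD : initial_zigzag n D.

Local Notation x j := (lam D [fset j; j.+1]).
Local Notation y j := (lam D [fset j; j.+2]).
Local Notation th j := (mu D [fset j; j.+1; j.+2]).
Local Notation w j := (wt_sigma D j).
Local Notation X j := (lam (flips n j D) [fset j; n]).
Local Notation box j := (mu (flips n j D) [fset j; j.+1; n]).
Local Notation B j := (ssqrt (X j * X j.+1 / x j) * box j).

Lemma side_pos j : (0 < j < n)%N -> (3 <= n)%N -> even_pos (x j).
Proof.
move=> hj hn; apply: (initial_lam hD).
have [h|h] := leqP j (n - 2).
  by exists j, j.+1, j; split; rewrite ?inE //; lia.
by exists j, j.+1, j.-1; split; rewrite ?inE //; lia.
Qed.

Lemma skip_pos j : (0 < j <= n - 2)%N -> even_pos (y j).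
Proof.
move=> hj; apply: (initial_lam hD); exists j, j.+2, j.
by split; rewrite ?inE //; lia.
Qed.

Lemma th_odd j : (0 < j <= n - 2)%N -> th j \in odd_part A.
Proof. exact: (initial_mu hD). Qed.

Lemma wt_sigma_odd j : (0 < j <= n - 2)%N -> w j \in odd_part A.
Proof.
move=> hj; apply: even_mul_odd; last exact: th_odd.
have h : even_pos (y j / (x j * x j.+1)).
  by apply: even_pos_div; [exact: skip_pos|apply: even_posM; apply: side_pos; lia].
by case: (ssqrt_pos h).
Qed.

Lemma fan_initial : (3 <= n)%N -> fan_state n D (n - 2) D.
Proof.
move=> hn; have e2 : ((n - 2).+2 = n)%N by lia.
split=> //.
- move=> z; rewrite (initial_triangles hD) => /imfsetP[j /=]; rewrite mem_iota => hj ->.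
  have [Ej|nj] := eqVneq j (n - 2)%N; last by constructor 1; exists j => //; lia.
  by constructor 2; rewrite Ej e2.
- move=> j hj; rewrite (initial_triangles hD); apply/imfsetP; exists j => //=.
  by rewrite mem_iota; lia.
- rewrite (initial_triangles hD); apply/imfsetP; exists (n - 2)%N; last by rewrite e2.
  by rewrite /= mem_iota; lia.
- by move=> j hj; apply: (initial_diagonal hD); lia.
Qed.

Lemma fan_flips k : (3 <= n)%N -> (0 < k <= n - 2)%N -> fan_state n D k (flips n k D).
Proof.
move=> hn; move Ed : (n - 2 - k)%N => d; elim: d k Ed => [|d IH] k Ed hk.
  have -> : k = (n - 2)%N by lia.
  by rewrite flips_id //; exact: fan_initial.
rewrite flipsS; last lia.
have h : fan_state n D k.+1 (flips n k.+1 D) by apply: IH; lia.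
by have [] := flip_fan (n := n) (k := k) ltac:(lia) ltac:(lia) h.
Qed.

(** The flips performed after stage [m] only create arcs from labels smaller than [m] to [n]. *)
Lemma fan_lengths k m : (3 <= n)%N -> (0 < k <= m)%N -> (m < n)%N ->
  lam (flips n k D) [fset m; n] = X m.
Proof.
move=> hn; move Ed : (n - 2 - k)%N => d; elim: d k Ed => [|d IH] k Ed hk hm.
  by rewrite !flips_id //; lia.
have [->//|nk] := eqVneq k m.
rewrite flipsS; last lia.
have h : fan_state n D k.+1 (flips n k.+1 D) by apply: fan_flips; lia.
have [_ E _ _] := flip_fan (n := n) (k := k) ltac:(lia) ltac:(lia) h.
rewrite (E m); [|lia|lia].
by apply: IH; lia.
Qed.

(* Both parities are brought to the same shape; only the order of the odd
   factors remembers on which side of the diagonal the triangle lies. *)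
Lemma fan_flip k : (0 < k)%N -> (k.+3 <= n)%N ->
  even_pos (X k.+1) -> even_pos (X k.+2) ->
  X k = (x k * X k.+2 + y k * X k.+1 + ssqrt (x k * y k * X k.+2 * X k.+1)
           * (if odd k then box k.+1 * th k else th k * box k.+1)) / x k.+1 /\
  box k = (th k * ssqrt (y k * X k.+1) + box k.+1 * ssqrt (x k * X k.+2))
            / ssqrt (x k * X k.+2 + y k * X k.+1).
Proof.
move=> k0 hk [e1 _] [e2 _].
have [ex _] := side_pos (j := k) ltac:(lia) ltac:(lia).
have [ey _] := skip_pos (j := k) ltac:(lia).
have h : fan_state n D k.+1 (flips n k.+1 D) by apply: fan_flips; lia.
have := flip_fan k0 hk h.
rewrite (fan_lengths (k := k.+1) (m := k.+2)); [|lia..].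
rewrite -flipsS //= => -[_ _ -> ->]; case: (odd k) => //; split.
  congr (_ / _); congr (_ + ssqrt _ * _).
    by rewrite addrC (even_central _ e1) (even_central _ e2).
  move: ex ey e1 e2 => /even_lift[a ->] /even_lift[b ->] /even_lift[c ->] /even_lift[d ->].
  by rewrite -!rmorphM; congr (\val _); ring.
rewrite addrC (even_central (y k) e1) (even_central (x k) e2).
by rewrite [y k * _ + _]addrC.
Qed.

(** Both claims are proved together because the nilpotent term of X_k involves the mu-invariant of
    stage k+1: it contains a product of two odd factors, hence has body 0, and the body of X_k comes
    from the positive terms alone. *)
Lemma fan_positive k : (3 <= n)%N -> (0 < k < n)%N ->
  even_pos (X k) /\ ((k <= n - 2)%N -> box k \in odd_part A).
Proof.
move=> hn; move Ed : (n - k)%N => d; elim/ltn_ind: d k Ed => d IH k Ed hk.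
have [hk2|hk2] := leqP (n - 2) k.
  rewrite flips_id //; split.
    have [E|E] : k = n.-1 \/ k = (n - 2)%N by lia.
      by rewrite (_ : n = k.+1); [apply: side_pos; lia|lia].
    by rewrite (_ : n = k.+2); [apply: skip_pos; lia|lia].
  by move=> h; rewrite (_ : n = k.+2); [apply: th_odd; lia|lia].
have [p1 o1] := IH (n - k.+1)%N ltac:(lia) k.+1 erefl ltac:(lia).
have [p2 _] := IH (n - k.+2)%N ltac:(lia) k.+2 erefl ltac:(lia).
have [-> ->] := fan_flip (k := k) ltac:(lia) ltac:(lia) p1 p2.
have px := side_pos (j := k) ltac:(lia) hn; have py := skip_pos (j := k) ltac:(lia).
have px1 := side_pos (j := k.+1) ltac:(lia) hn; have ot := th_odd (j := k) ltac:(lia).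
have {}o1 := o1 ltac:(lia).
have pN := even_posD (even_posM px p2) (even_posM py p1).
split.
  apply: even_pos_div => //; have [eN bN] := pN.
  have [es _] := ssqrt_pos (even_posM (even_posM (even_posM px py) p2) p1).
  set c := if _ then _ else _.
  have ec : c \in even_part A by rewrite /c; case: ifP => _; apply: odd_mul_odd.
  have bc : body A c = 0.
    by rewrite /c; case: ifP => _; rewrite rmorphM (body_odd ot) ?mulr0 ?mul0r.
  split; first by rewrite evenD // even_mul_even.
  by rewrite rmorphD rmorphM bc mulr0 addr0.
move=> _; apply: odd_mul_even; last by apply: even_inv; case: (ssqrt_pos pN).
by apply: odd_partD; apply: odd_mul_even => //;
  [case: (ssqrt_pos (even_posM py p1))|case: (ssqrt_pos (even_posM px p2))].
Qed.

Lemma fan_rec k : (0 < k)%N -> (k.+3 <= n)%N ->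
  B k = B k.+1 + X k.+1 * w k /\
  X k = x k / x k.+1 * X k.+2 + y k / x k.+1 * X k.+1
        + x k * (if odd k then B k.+1 * w k else w k * B k.+1).
Proof.
move=> k0 hk; have hn : (3 <= n)%N by lia.
have [p0 _] := fan_positive (k := k) hn ltac:(lia).
have [p1 o1] := fan_positive (k := k.+1) hn ltac:(lia).
have [p2 _] := fan_positive (k := k.+2) hn ltac:(lia).
have {}o1 := o1 ltac:(lia).
have px := side_pos (j := k) ltac:(lia) hn; have py := skip_pos (j := k) ltac:(lia).
have px1 := side_pos (j := k.+1) ltac:(lia) hn; have ot := th_odd (j := k) ltac:(lia).
have [eX eb] := fan_flip k0 hk p1 p2.
have ps := ssqrt_pos (even_posM (even_posM (even_posM px py) p2) p1).
set M := (X in _ = X / _) in eX.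
have eM : M = X k * x k.+1 by rewrite eX mulrVK // even_pos_unit.
have pM : even_pos M by rewrite eM; exact: even_posM.
set c := if odd k then _ else _ in M eX eM pM.
have Msub : M - (x k * X k.+2 + y k * X k.+1) = ssqrt (x k * y k * X k.+2 * X k.+1) * c.
  by rewrite /M addrC addKr.
(* [c] is the product of [th k] and [box k.+1] in one of the two orders, and each of these squares
   to zero. *)
have [ct cb] : c * th k = 0 /\ c * box k.+1 = 0.
  have bb := odd_sqr o1; have tt := odd_sqr ot; have bt := odd_anticomm o1 ot.
  rewrite /c; case: ifP => _; split.
  - by rewrite -mulrA tt mulr0.
  - by rewrite bt mulNr -mulrA bb mulr0 oppr0.
  - by rewrite -[_ * box _]opprK -bt mulNr -mulrA tt mulr0 oppr0.
  - by rewrite -mulrA bb mulr0.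
split.
  rewrite {1}eX eb (ptolemy_box px px1 py p1 p2 pM) //.
  - by rewrite Msub -mulrA ct mulr0.
  - by rewrite Msub -mulrA cb mulr0.
have [[ex _] [ey _]] := (px, py); have [[e1 _] [e2 _]] := (p1, p2).
have ei : (x k.+1)^-1 \in even_part A by apply: even_inv; case: px1.
rewrite {1}eX /M !mulrDl; congr (_ + _ + _).
- by rewrite -!mulrA (even_central (x k.+1)^-1 e2).
- by rewrite -!mulrA (even_central (x k.+1)^-1 e1).
have -> : ssqrt (x k * y k * X k.+2 * X k.+1) * c / x k.+1
       = ssqrt (x k * y k * X k.+2 * X k.+1) / x k.+1 * c.
  by rewrite -!mulrA -(even_central c ei).
rewrite ptolemy_sqrt // -mulrA; congr (_ * _).
have [eS _] := ssqrt_pos (even_pos_div (even_posM p1 p2) px1).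
have [eT _] := ssqrt_pos (even_pos_div py (even_posM px px1)).
rewrite /wt_sigma /c; move: eS eT; move: (ssqrt _) (ssqrt _) => s1 s2 eS eT; case: ifP => _.
  by rewrite -!mulrA (even_mulCA (box k.+1)).
by rewrite -!mulrA (even_mulCA (th k) _ eS) (even_mulCA _ _ eS).
Qed.

End FanRecursion.

(** * Enumeration of super T-paths *)

Section PathEnumeration.
Variable n : nat.
Local Open Scope nat_scope.
Implicit Types (e : gedge) (es : seq gedge) (u v : gvertex) (i j l m p q : nat).

Definition edge_ok i e : bool :=
  match e with
  | Arc p q => [&& i <= p, p < q, q <= p.+2 & q <= n]
  | Sigma j => i <= j <= n - 2
  | Tau j l => [&& i <= j, j < l & l <= n - 2]
  end.

Lemma edge_okP i e : 0 < i <= n - 2 -> reflect (is_edge n i e) (edge_ok i e).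
Proof.
move=> hi; case: e => [p q|j|j l] /=; [|exact: idP|exact: and3P].
apply: (iffP idP) => [h|[hpq [j [hj hp hq]]]].
  split; first lia.
  have [hp|hp] := leqP p (n - 2).
    by exists p; rewrite !inE; split; lia.
  (* Only (n-1,n) remains, and its triangle is the last one. *)
  by exists p.-1; rewrite !inE; split; lia.
by move: hp hq; rewrite !inE; lia.
Qed.

Lemma edge_ok_mono i m e : i <= m -> edge_ok m e -> edge_ok i e.
Proof. by move=> him; case: e => [p q|j|j l] /=; lia. Qed.

Definition other e u : gvertex :=
  if (ends e).1 == u then (ends e).2 else (ends e).1.

(* [b] tells whether the next step is an odd one. *)
Fixpoint walk i (b : bool) u es : bool :=
  if es is e :: es' then
    [&& edge_ok i e, ((ends e).1 == u) || ((ends e).2 == u),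
        (if b then ~~ is_sigma e else isSome (crossing n i e))
      & walk i (~~ b) (other e u) es']
  else (u == inl n) && ~~ b.

Definition vertices u es : seq gvertex := scanl (fun w e => other e w) u es.

Lemma joinsP i e u v : edge_ok i e ->
  joins e u v = (((ends e).1 == u) || ((ends e).2 == u)) && (v == other e u).
Proof.
move=> h; have ne : (ends e).1 != (ends e).2.
  case: e h => [p q|j|j l] //= h; apply/eqP => -[E]; lia.
rewrite /joins /other; case: (ends e) ne => x y /= ne.
rewrite !xpair_eqE; move: ne; have [->|nx] /= := eqVneq x u => ne.
  by rewrite [y == u]eq_sym (negPf ne) andbF orbF eq_sym.
by rewrite andbC [x == v]eq_sym.
Qed.

(** An admissible edge has distinct ends, so a start vertex and a list of edges determine all the
    vertices. The test at even steps already excludes tau-edges, which have no crossing position. *)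
Lemma walkP i b u vs es : 0 < i <= n - 2 -> size vs = size es ->
  ([/\ forall s, s < size es -> [/\ is_edge n i (nth (Arc 0 0) es s),
          joins (nth (Arc 0 0) es s) (nth (inl 0) (u :: vs) s) (nth (inl 0) vs s)
        & if b (+) odd s then ~~ is_sigma (nth (Arc 0 0) es s)
          else isSome (crossing n i (nth (Arc 0 0) es s))],
      last u vs = inl n & odd (size es) = b])
  <-> vs = vertices u es /\ walk i b u es.
Proof.
move=> hi; elim: es b u vs => [|e es IH] b u [|v vs] //= hs.
  by split=> [[_ -> <-]|[_ /andP[/eqP-> /negPf->]]] //; rewrite eqxx.
case: hs => hs; have := IH (~~ b) (other e u) vs hs => {}IH; split.
  move=> [H hl ho]; have [/= /(edge_okP _ hi) He] := H 0 isT.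
  rewrite (joinsP _ _ He) => /andP[He1 /eqP Ev] Hc; rewrite Ev in hl H *.
  have [->  ->] : vs = vertices (other e u) es /\ walk i (~~ b) (other e u) es.
    apply/IH; split=> //; last by rewrite -ho negbK.
    by move=> s hs'; have [] := H s.+1 hs'; rewrite /= addbN -addNb; split.
  by split=> //; rewrite He He1 /= andbT; move: Hc; rewrite addbF.
move=> [[-> E] /and4P[He He1 Hc Hw]]; rewrite {}E in IH hs *.
have [H hl ho] := (IH).2 (conj erefl Hw).
split=> //; last by rewrite ho negbK.
case=> [|s] hs'; last by have [] := H s hs'; rewrite /= addbN -addNb; split.
split=> /=; first exact/(edge_okP _ hi).
  by rewrite (joinsP _ _ He) He1 eqxx.
by rewrite addbF.
Qed.

Definition good i es : bool :=
  [&& walk i true (inl i) es, uniq es & sorted ltn (pmap (crossing n i) es)].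

Lemma super_TpathP i vs es : 0 < i <= n - 2 ->
  super_Tpath n i (vs, es) <-> vs = inl i :: vertices (inl i) es /\ good i es.
Proof.
move=> hi; split.
  case=> /= hs h0 hl he hj hu ho hc hsi ht hinc.
  case: vs hs h0 hl he hj hc hsi ht => // v vs /= [hs] -> hl he hj hc hsi ht.
  have [] : vs = vertices (inl i) es /\ walk i true (inl i) es.
    apply/walkP => //; split=> //; last first.
      by rewrite (last_nth (inl 0)) hs.
    move=> s hs'; split; [exact: (he s.+1)|exact: (hj s.+1)|].
    rewrite addTb; case: ifPn => hos; last first.
      by have := hc s.+1 hs' hos; rewrite /step /=; case: crossing.
    by apply/negP => /(hsi s.+1 hs') /=; rewrite hos.
  by move=> -> hw; rewrite /good hw hu hinc.
move=> [-> /and3P[hw hu hinc]].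
have hs : size (vertices (inl i) es) = size es by rewrite size_scanl.
have [H hl ho] := (walkP true (inl i) hi hs).2 (conj erefl hw).
split=> //=; first by rewrite hs.
- by rewrite -hs -last_nth.
- by case=> // s /H[].
- by case=> // s /H[].
- by case=> // s /H[_ _ h] /= hos; move: h; rewrite addTb /step (negPf hos) /=; case: crossing.
- case=> // s /H[_ _ h] /= hsi; rewrite /step /= in hsi *; move: h.
  by rewrite hsi /=; case: (odd s).
- case=> // s /H[_ _ h] /=; rewrite /step /= => hta; move: h.
  by rewrite addTb; case: (odd s) => //=; case: (nth _ _ _) hta.
Qed.

(** In the first case the arc (m+1,m+2) would occur at steps 2 and 3, with reciprocal weights. *)
Definition detour m es : seq gedge :=
  if ohead es == Some (Arc m.+1 m.+2) then Arc m m.+2 :: behead es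
  else [:: Arc m m.+2, Arc m.+1 m.+2 & es].

(* [f] is fuel; [n - m <= f] suffices. *)
Fixpoint paths f m : seq (seq gedge) :=
  if f is f'.+1 then
    if n <= m.+2 then [:: [:: Arc m n]]
    else [seq [:: Arc m m.+1, Arc m.+1 m.+2 & es] | es <- paths f' m.+2]
      ++ [seq detour m es | es <- paths f' m.+1]
      ++ [seq [:: Arc m m.+1, Sigma m, Tau m l, Sigma l & es]
            | l <- index_iota m.+1 n.-1, es <- paths f' l.+1]
  else [::].

Lemma paths_small f m : m < n <= m.+2 -> n - m <= f -> paths f m = [:: [:: Arc m n]].
Proof. by case: f => [|f] /= h1 h2; [lia|rewrite ifT //; lia]. Qed.

Lemma pathsS f m es : m.+2 < n ->
  reflect [\/ exists2 es', es' \in paths f m.+2 & es = [:: Arc m m.+1, Arc m.+1 m.+2 & es'],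
              exists2 es', es' \in paths f m.+1 & es = detour m es'
            | exists l es', [/\ m < l <= n - 2, es' \in paths f l.+1
                & es = [:: Arc m m.+1, Sigma m, Tau m l, Sigma l & es']]]
    (es \in paths f.+1 m).
Proof.
move=> hm; rewrite /= ifF; last lia.
rewrite !mem_cat; apply: (iffP or3P).
  case=> [/mapP[es' h ->]|/mapP[es' h ->]|/allpairsPdep[l [es' [hl h ->]]]].
  - by constructor 1; exists es'.
  - by constructor 2; exists es'.
  - by constructor 3; exists l, es'; split=> //; move: hl; rewrite mem_index_iota; lia.
case=> [[es' h ->]|[es' h ->]|[l [es' [hl h ->]]]].
- by constructor 1; apply/mapP; exists es'.
- by constructor 2; apply/mapP; exists es'.
- constructor 3; apply/allpairsPdep; exists l, es'; split=> //.
  by rewrite mem_index_iota; lia.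
Qed.

(** Unlike [crossing], this does not depend on the sub-polygon, so its monotonicity can be carried
    from one starting vertex to another. It also gives a position to the side (i,i+1), which does
    not cross (i,n). *)
Definition pos e : option nat :=
  match e with
  | Arc p q => if q == p.+1 then Some p.-1.*2.+1 else None
  | Sigma j => Some j.*2
  | Tau _ _ => None
  end.

Lemma crossing_pos i e c : crossing n i e = Some c -> pos e = Some c.
Proof. by case: e => [p q|j|j l] //=; case: eqP => //= _; case: ifP. Qed.

Lemma subseq_crossing i es : subseq (pmap (crossing n i) es) (pmap pos es).
Proof.
elim: es => //= e es IH; case E: crossing => [c|] /=.
  by rewrite (crossing_pos E) /= eqxx.
by case: pos => //= c; apply: subseq_trans IH (subseq_cons _ _).
Qed.

Lemma walk_mono i m b u es : i <= m -> walk m b u es -> walk i b u es.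
Proof.
move=> him; elim: es b u => //= e es IH b u /and4P[h1 -> h3 /IH ->].
rewrite (edge_ok_mono him h1) /= andbT; case: b h3 => //.
by case: e h1 => [p q|j|j l] //= h1; do 2 case: ifP => //; lia.
Qed.

Lemma walk_edge_ok i b u es : walk i b u es -> all (edge_ok i) es.
Proof. by elim: es b u => //= e es IH b u /and4P[-> _ _ /IH]. Qed.

Lemma edge_ok_notin m e es : all (edge_ok m) es -> ~~ edge_ok m e -> e \notin es.
Proof. by move=> /allP h; apply: contra => /h. Qed.

Lemma pos_lb m es c : 0 < m -> all (edge_ok m) es -> c < m.-1.*2.+1 ->
  all (ltn c) (pmap pos es).
Proof.
move=> hm + hc; elim: es => //= e es IH /andP[h1 /IH h].
case E: pos => [d|] //=; rewrite h andbT.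
by case: e h1 E => [p q|j|j l] //=; [case: ifP => // _|] => h1 [] ; lia.
Qed.

(** Among the edges on labels at least [m], only (m,m+1) has the lowest possible position. *)
Lemma pos_lb_strict m es : 0 < m -> all (edge_ok m) es -> Arc m m.+1 \notin es ->
  all (ltn m.-1.*2.+1) (pmap pos es).
Proof.
move=> hm; elim: es => //= e es IH /andP[h1 h2]; rewrite inE negb_or => /andP[ne h3].
have h := IH h2 h3; case E: pos => [d|] //=; rewrite h andbT.
case: e h1 E ne => [p q|j|j l] //=; last by move=> h1 []; lia.
case: eqP => // -> h1 [<-] ne; have [E|] := eqVneq p m; last lia.
by rewrite E eqxx in ne.
Qed.

Definition sigmas es : seq nat :=
  pmap (fun e => if e is Sigma j then Some j else None) es.

(** Invariants of the recursion. [sound_even] makes the product of the sigma-weights central;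
    [sound_head] guarantees that a detour does not use (m+1,m+2) twice. *)
Record sound m es : Prop := Sound {
  sound_walk : walk m true (inl m) es;
  sound_uniq : uniq es;
  sound_sorted : sorted ltn (pmap pos es);
  sound_even : ~~ odd (size (sigmas es));
  sound_head : ohead es = Some (Arc m m.+1) \/ all (edge_ok m.+1) (behead es)
}.

Lemma sorted_consP (c : nat) (s : seq nat) : all (ltn c) s -> sorted ltn s -> sorted ltn (c :: s).
Proof. by move=> h1 h2; rewrite /= path_min_sorted. Qed.

Lemma paths_sound f m es : 0 < m < n -> n - m <= f -> es \in paths f m -> sound m es.
Proof.
elim: f m es => [|f IH] m es hm hf; first lia.
have [hn|hn] := leqP n m.+2.
  rewrite paths_small // ?inE => [/eqP->|]; last lia.
  split=> //=; last by right.
  - by rewrite /other /= !eqxx /=; lia.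
  - by case: ifP.
case/(pathsS _ _ hn) => [[es' h ->]|[es' h ->]|[l [es' [hl h ->]]]].
- have [|//|hw hu hs he hh] := IH m.+2 es' _ _ h; first lia; first lia.
  have ok := walk_edge_ok hw.
  split=> //; last by left.
  + rewrite /= /other /= !eqxx (_ : inl m.+1 == inl m = false); last first.
      by apply/eqP => -[]; lia.
    by rewrite (walk_mono _ hw) ?orbT /=; [case: ifP => /= *; lia|lia].
  + rewrite /= inE negb_or hu (edge_ok_notin ok) ?(edge_ok_notin ok) //=; try lia.
    by rewrite !andbT; apply/eqP => -[]; lia.
  + rewrite /= !eqxx; apply: sorted_consP; last apply: sorted_consP => //.
      rewrite /= ; apply/andP; split; first lia.
      apply: (pos_lb _ ok); lia.
    apply: (pos_lb _ ok); lia.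
- have [|//|hw hu hs he hh] := IH m.+1 es' _ _ h; first lia; first lia.
  have ok := walk_edge_ok hw.
  rewrite /detour; case: eqP => hd.
    case: es' hd hw hu hs he ok {h hh} => //= e es' [->].
    move=> /and4P[_ _ _ hw] /andP[_ hu] hs he /andP[_ ok].
    split=> //=; last by right.
    + move: hw; rewrite /other /= !eqxx; case: eqP => [[]|_ hw]; first lia.
      rewrite (walk_mono _ hw) //; lia.
    + rewrite hu andbT; apply: (edge_ok_notin ok); rewrite /=; lia.
    + rewrite ifF; last lia.
      move: hs; rewrite /= eqxx => hs; exact: path_sorted hs.
  (* By [sound_head] the arc (m+1,m+2) could occur only as the first edge, and this is excluded by
     [hd]. *)
  have nin : Arc m.+1 m.+2 \notin es'.
    case: hh => // ok2; case: es' hd ok2 {h hw hu hs he ok} => //= e es' hd ok2.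
    rewrite inE negb_or (edge_ok_notin ok2) ?andbT; last by rewrite /=; lia.
    by apply/eqP => E; apply: hd; rewrite E.
  split=> //.
  + rewrite /= /other /= !eqxx (_ : (inl m.+1 : gvertex) == inl m.+2 = false); last first.
      by apply/eqP => -[]; lia.
    by rewrite (walk_mono _ hw) ?orbT /=; [case: ifP => /= *; lia|lia].
  + rewrite /= inE negb_or nin hu (edge_ok_notin ok) //=; last lia.
    by rewrite !andbT; apply/eqP => -[]; lia.
  + rewrite /= eqxx (_ : m.+2 == m.+1 = false) /=; last lia.
    apply: sorted_consP => //; exact: (pos_lb_strict _ ok nin).
  + right; rewrite /= ok andbT; lia.
- have [|//|hw hu hs he hh] := IH l.+1 es' _ _ h; first lia; first lia.
  have ok := walk_edge_ok hw.
  split=> //; last by left.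
  + rewrite /= /other /= !eqxx /=.
    by rewrite (walk_mono _ hw) ?orbT /=; lia.
  + rewrite /= !inE !negb_or hu !(edge_ok_notin ok) //=; try lia.
    rewrite !andbT; apply/eqP => -[]; lia.
  + rewrite /= eqxx; apply: sorted_consP; last apply: sorted_consP; last apply: sorted_consP => //.
    * rewrite /=; apply/and3P; split; [lia|lia|]; apply: (pos_lb _ ok); lia.
    * rewrite /=; apply/andP; split; [lia|]; apply: (pos_lb _ ok); lia.
    * apply: (pos_lb _ ok); lia.
  + by rewrite /= negbK.
Qed.

Lemma walk_odd_step i m e es : walk i true (inl m) (e :: es) ->
  exists p q, [/\ e = Arc p q, i <= p < q, q <= p.+2, q <= n
    & (p = m /\ walk i false (inl q) es) \/ (q = m /\ walk i false (inl p) es)].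
Proof.
case: e => [p q|j|j l] /=; [|by rewrite !andbF|by rewrite !andbF].
case/and3P => h1 +; rewrite /other /=.
have [[Ep]|ne] := eqVneq (inl p : gvertex) (inl m) => /= [_|/eqP[Eq]] hw; subst m.
  by exists p, q; split=> //; [lia|lia|lia|left].
by exists p, q; split=> //; [lia|lia|lia|right].
Qed.

Lemma walk_even_step i p e es : 0 < i -> walk i false (inl p) (e :: es) ->
  [\/ [/\ e = Arc p p.+1, crossing n i e = Some p.-1.*2.+1, p.+1 < n & walk i true (inl p.+1) es],
      exists q, [/\ p = q.+1, e = Arc q q.+1, crossing n i e = Some q.-1.*2.+1, p < n
                  & walk i true (inl q) es]
    | exists j, [/\ p = j.+1, e = Sigma j, i <= j <= n - 2 & walk i true (inr j) es]].
Proof.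
move=> hi; case: e => [q r|j|j l] /=; [| |by rewrite !andbF].
  case/and4P => h1 + h3; rewrite /other /=.
  move: h3; have [-> /=|//] := eqVneq r q.+1.
  have [[E]|ne] := eqVneq (inl q : gvertex) (inl p) => /=; [subst p|].
    by case: ifP => // h2 _ _ hw; constructor 1; split=> //; lia.
  by case: ifP => // h2 _ /eqP[<-] hw; constructor 2; exists q; split=> //; lia.
case/and3P => h1 /eqP[<-] hw; constructor 3; exists j; split=> //.
Qed.

(** At an odd step only a tau-edge can leave theta_j, as sigma-edges are reserved for even steps;
    the next step is even and must leave theta_l along sigma_l. *)
Lemma walk_tau_step i j es : walk i true (inr j) es ->
  exists l es', [/\ es = [:: Tau j l, Sigma l & es'] \/ es = [:: Tau l j, Sigma l & es'],
    es = [:: Tau j l, Sigma l & es'] -> j < l <= n - 2,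
    es = [:: Tau l j, Sigma l & es'] -> l < j
    & walk i true (inl l.+1) es'].
Proof.
case: es => [|[p q|k|a b] es] //=; try by rewrite !andbF.
case/and3P => h1 +; rewrite /other /=.
have sig l : walk i false (inr l) es ->
    exists2 es', es = Sigma l :: es' & walk i true (inl l.+1) es'.
  case: es => [|[p q|k|c d] es] //=; try by rewrite !andbF.
  by case/and3P => h /orP[/eqP[->]|/eqP//]; rewrite /other /= eqxx => hw; exists es.
have [[E]|ne] := eqVneq (inr a : gvertex) (inr j) => /= [_|/eqP[E]] /sig[es' -> hw]; subst j.
  exists b, es'; split=> //; [by left|lia|by case; lia].
by exists a, es'; split=> //; [by right|case; lia|lia].
Qed.

Lemma sorted_pmap_cons i e es : sorted ltn (pmap (crossing n i) (e :: es)) ->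
  sorted ltn (pmap (crossing n i) es) /\
  forall c, crossing n i e = Some c -> all (ltn c) (pmap (crossing n i) es).
Proof.
rewrite /=; case E: crossing => [c|] //= h; split; first exact: path_sorted h.
by move=> _ [<-]; apply: order_path_min h => //; exact: ltn_trans.
Qed.

Lemma all_pmap_cons i e es (a : pred nat) : all a (pmap (crossing n i) (e :: es)) ->
  all a (pmap (crossing n i) es) /\ forall c, crossing n i e = Some c -> a c.
Proof. by rewrite /=; case E: crossing => [c|] //=; case/andP=> h ->; split=> // _ [<-]. Qed.

(** A suffix of a path from [i] is compared with the paths from its own start [m]. The lower bound
    on crossing positions keeps the suffix from returning below [m]; [N] bounds the number of
    edges. *)
Lemma paths_complete i N f m es : size es <= N -> 0 < i <= m -> m < n -> n - m <= f ->
  walk i true (inl m) es -> uniq es -> sorted ltn (pmap (crossing n i) es) ->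
  all (leq m.-1.*2) (pmap (crossing n i) es) -> es \in paths f m.
Proof.
elim: N f m es => [|N IH] f m [|e1 es1] //=; try by rewrite andbF.
case: f => [|f] hN hi hmn hf; first lia. have hi0 : 0 < i by lia.
rewrite -/(walk i true (inl m) (e1 :: es1)) -/(pmap _ (e1 :: es1)).
move=> /walk_odd_step[p [q [E1 hpq hq hqn hw]]].
case/andP => n1 hu /sorted_pmap_cons[hs _] /all_pmap_cons[ha _].
case: es1 hN n1 hu hs ha hw => [|e2 es2] hN n1 hu hs ha hw.
  case: hw => -[E /=]; last first.
    by rewrite andbT => /eqP[]; lia.
  rewrite andbT => /eqP[Eq]; rewrite ifT; last lia.
  by rewrite E1 E Eq inE.
(* Stepping down to a label below [m] would force the next crossing under the bound 2(m-1). *)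
have {}hw : p = m /\ walk i false (inl q) (e2 :: es2).
  case: hw => // -[E hw]; have [ha1 ha2] := all_pmap_cons ha.
  case/(walk_even_step hi0): hw => [[Ee Ec _ _]|[r [Ep Ee Ec _ _]]|[j [Ep Ee _ _]]].
  - by have := ha2 _ Ec; lia.
  - by have := ha2 _ Ec; lia.
  - by have := ha2 j.*2; rewrite Ee /= => /(_ erefl); lia.
case: hw => Ep hw; rewrite {}Ep in E1 hpq hq.
have [hs1 hs2] := sorted_pmap_cons hs.
move: hu => /= /andP[n2 hu].
have tau_case j : walk i true (inr j) es2 -> e2 = Sigma j -> m <= j -> 
    exists l es', [/\ es2 = [:: Tau j l, Sigma l & es'], j < l <= n - 2
      & forall g, n - l.+1 <= g -> es' \in paths g l.+1].
  move=> /walk_tau_step[l [es' [Es h1 h2 hw']]] E2 hmj.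
  (* The edge sigma_l comes after sigma_j, so its position 2l must exceed 2j. *)
  have hp : j < l.
    case: Es => Es; first by case/andP: (h1 Es).
    have := hs2 j.*2; rewrite E2 => /(_ erefl); rewrite Es /= => /andP[]; lia.
  have {}Es : es2 = [:: Tau j l, Sigma l & es'] by case: Es => // /h2; lia.
  exists l, es'; split=> //; first exact: h1.
  move=> g hg; have hl := h1 Es; apply: IH => //; try lia.
  - by move: hN; rewrite Es /=; lia.
  - by move: hu; rewrite Es /= => /and3P[].
  - by move: hs1; rewrite Es /= => /path_sorted.
  - move: hs1; rewrite Es /= => /(order_path_min ltn_trans) /sub_all; apply => c /=.
    lia.
have next g k : n - k <= g -> m < k < n -> walk i true (inl k) es2 ->
    (exists2 c, crossing n i e2 = Some c & k.-1.*2 <= c.+1) -> es2 \in paths g k.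
  move=> hk1 hk2 hw2 [c Ec hc]; apply: IH => //; try lia.
  - by move: hN => /=; lia.
  - by apply: sub_all (hs2 _ Ec) => d /=; lia.
have [Eq|Eq] : q = m.+1 \/ q = m.+2 by lia.
  rewrite {q hq hqn hpq}Eq in E1 hw hqn.
  case/(walk_even_step hi0): hw => [[Ee Ec hn hw]|[r [[Er] Ee Ec hr hw]]|[j [[Ej] Ee hj hw]]].
  - apply/pathsS => //; constructor 1; exists es2; last by rewrite E1 Ee.
    apply: next => //; try lia.
    by eexists; [exact: Ec|lia].
  (* Going back along the arc just used would repeat an edge. *)
  - by move: n1; rewrite E1 Ee Er inE eqxx.
  - subst j; have [l [es' [-> hl h]]] := tau_case _ hw Ee (leqnn _).
    apply/pathsS; first lia.
    by constructor 3; exists l, es'; split=> //; [apply: h; lia|rewrite E1 Ee].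
rewrite {q hq hqn hpq}Eq in E1 hw hqn.
case/(walk_even_step hi0): hw => [[Ee Ec hn hw]|[r [[Er] Ee Ec hr hw]]|[j [[Ej] Ee hj hw]]].
- apply/pathsS; first lia.
  (* The preimage puts back the arc (m+1,m+2) that the detour has cancelled. *)
  constructor 2; exists [:: Arc m.+1 m.+2, e2 & es2]; last first.
    by rewrite /detour /= eqxx E1.
  case: f hf => [|f] hf; first lia.
  apply/pathsS => //; constructor 1; exists es2; last by rewrite Ee.
  by apply: next => //; [lia|lia|eexists; [exact: Ec|lia]].
- subst r; apply/pathsS; first lia.
  constructor 2; exists es2.
    by apply: next => //; [lia|lia|eexists; [exact: Ec|lia]].
  rewrite /detour E1 -Ee; case: eqP => // hd; move: n2.
  by case: (es2) hd => //= a es3 [->]; rewrite inE eqxx.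
- subst j; have [l [es' [-> hl h]]] := tau_case _ hw Ee (leqnSn _).
  apply/pathsS; first lia.
  constructor 2; exists [:: Arc m.+1 m.+2, Sigma m.+1, Tau m.+1 l, Sigma l & es']; last first.
    by rewrite /detour /= eqxx E1 Ee.
  case: f hf => [|f] hf; first lia.
  apply/pathsS; first lia.
  by constructor 3; exists l, es'; split=> //; apply: h; lia.
Qed.

(** A cancelled and an uncancelled detour could agree only if the list before cancellation contained
    (m+1,m+2) twice, which a duplicate-free list does not. *)
Lemma detour_inj m : {in [pred es | uniq es] &, injective (detour m)}.
Proof.
move=> es es'; rewrite !inE /detour => hu hu'.
case: eqP => hd; case: eqP => hd' //= [].
- by case: es es' hd hd' {hu hu'} => [|a es] [|a' es'] //= [->] [->] ->.
- by case: es hd hu => //= a es [->] + E; rewrite E inE eqxx.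
- by case: es' hd' hu' => //= a es' [->] + E; rewrite -E inE eqxx.
- by [].
Qed.

(** The three families are told apart by their first edges: (m,m+1) then (m+1,m+2), or (m,m+2), or
    (m,m+1) then sigma_m. *)
Lemma paths_uniq f m : 0 < m < n -> n - m <= f -> uniq (paths f m).
Proof.
elim: f m => [|f IH] m hm hf; first lia.
have [hn|hn] := leqP n m.+2; first by rewrite paths_small //; lia.
rewrite /= ifF; last lia.
rewrite !cat_uniq; apply/and3P; split.
- by rewrite map_inj_uniq => [|? ? []//]; apply: IH; lia.
- apply/hasPn => es; rewrite mem_cat => /orP[/mapP[es' _ ->]|].
    apply/negP => /mapP[es'' _]; rewrite /detour; case: ifP => _ [] ; lia.
  by case/allpairsPdep => l [es' [_ _ ->]]; apply/negP => /mapP[es'' _ []].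
- have un es : es \in paths f m.+1 -> uniq es.
    by move=> /paths_sound[]//; lia.
  apply/and3P; split.
  + rewrite map_inj_in_uniq; first by apply: IH; lia.
    by move=> es es' /un h /un h'; apply: detour_inj.
  + apply/hasPn => es /allpairsPdep[l [es' [_ _ ->]]]; apply/negP => /mapP[es'' _].
    by rewrite /detour; case: ifP => _ []; lia.
  + apply: allpairs_uniq_dep.
    * exact: iota_uniq.
    * by move=> l; rewrite mem_index_iota => hl; apply: IH; lia.
    * by move=> [l es] [l' es'] _ _ /= [-> _ ->].
Qed.

Definition with_vertices i es : gpath := (inl i :: vertices (inl i) es, es).

Lemma Tpaths_paths f i : 0 < i < n -> n - i <= f ->
  Tpaths n i = [set` [seq with_vertices i es | es <- paths f i]].
Proof.
move=> hi hf; rewrite /Tpaths; case: ifP => hs.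
  rewrite paths_small; [|lia|lia]; apply/seteqP; split=> t /=; rewrite inE.
    by move=> ->; rewrite /with_vertices /= /other /= eqxx.
  by move=> /eqP ->; rewrite /with_vertices /= /other /= eqxx.
have hi2 : 0 < i <= n - 2 by lia.
apply/seteqP; split=> -[vs es] /=.
  move=> /(super_TpathP _ _ hi2)[-> /and3P[hw hu hso]].
  apply/mapP; exists es => //.
  apply: (paths_complete (leqnn _) _ _ hf hw hu hso); [lia|lia|].
  move: (walk_edge_ok hw); elim: es {hw hu hso} => //= e es IH /andP[he /IH{}IH].
  case E: crossing => [c|] //=; rewrite IH andbT.
  move: he E; case: e => [p q|j|j l] //= he; last by move=> [<-]; lia.
  by case: ifP => // h [<-]; lia.
case/mapP => es' h [-> ->]; have [||hw hu hso _ _] := paths_sound _ _ h; [lia|lia|].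
apply/super_TpathP => //.
split=> //; rewrite /good hw hu /=.
by apply: subseq_sorted (subseq_crossing _ _) hso; exact: ltn_trans.
Qed.

End PathEnumeration.

(** * Weights *)

Section SortedSigmas.
Variable n : nat.
Local Open Scope nat_scope.

Lemma pos_gtE j l : 0 < j <= n - 2 -> 0 < l <= n - 2 ->
  pos_gt n j l = (j < l) && ~~ odd j || (l < j) && odd l.
Proof.
move=> hj hl; rewrite /pos_gt.
have [/= _ ->] := ccw_prev (n := n) (j := j.+1) ltac:(lia).
by have [/= _ ->] := ccw_prev (n := n) (j := l.+1) ltac:(lia); rewrite negbK;
  case: ltngtP => //= _; rewrite orbF.
Qed.

Definition pos_ge j l := (j == l) || pos_gt n j l.

(** The smallest index is extremal in the positive order: below all the others if odd, above them if
    even. The relation is proved to be a total order on the labels 1 to n-2 only, hence the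
    relativised sorting lemmas. *)
Lemma sort_pos_cons k (s : seq nat) : 0 < k -> all (fun j => k < j <= n - 2) s ->
  k <= n - 2 ->
  sort pos_ge (k :: s) = if odd k then rcons (sort pos_ge s) k else k :: sort pos_ge s.
Proof.
move=> k0 hs hk; set P := [pred j | 0 < j <= n - 2].
have geE j l : j \in P -> l \in P -> pos_ge j l =
    [|| j == l, (j < l) && ~~ odd j | (l < j) && odd l].
  by move=> hj hl; rewrite /pos_ge pos_gtE.
have tot : {in P &, total pos_ge}.
  move=> j l hj hl; rewrite !geE //.
  by case: (odd j); case: (odd l); case: ltngtP.
have tr : {in P & &, transitive pos_ge}.
  move=> j i l hj hi hl; rewrite !geE //.
  have [->//|nij] := eqVneq i j; have [<- h _|njl] := eqVneq j l; first by rewrite (negPf nij).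
  by case: (odd j); case: (odd l); case: (odd i) => /=; lia.
have anti : {in P &, antisymmetric pos_ge}.
  move=> j l hj hl; rewrite !geE //; have [->//|njl] := eqVneq j l.
  by case: (odd j); case: (odd l) => /=; lia.
have Ps : all P s by apply: sub_all hs => j /=; lia.
have Pks : all P (k :: s) by rewrite /= Ps andbT; lia.
have so := sort_sorted_in tot Ps.
have Pss : all P (sort pos_ge s) by rewrite all_sort.
have pw : pairwise pos_ge (sort pos_ge s) by rewrite -(sorted_pairwise_in tr).
have ins j : j \in sort pos_ge (k :: s) -> j \in P.
  by rewrite mem_sort => /(allP Pks).
have cmp j : j \in sort pos_ge s -> if odd k then pos_ge j k else pos_ge k j.
  rewrite mem_sort => js; have := allP hs _ js => hj; have Pj := allP Ps _ js.
  have Pk : k \in P by rewrite inE; lia.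
  rewrite !geE //; case: (odd k); lia.
apply: (@sorted_eq_in _ pos_ge).
- by move=> a b c /ins ha /ins hb /ins hc; apply: tr.
- by move=> a b /ins ha /ins hb; apply: anti.
- exact: (sort_sorted_in tot).
- apply: pairwise_sorted; case: (odd k) cmp => cmp.
    by rewrite pairwise_rcons pw andbT; apply/allP.
  by rewrite pairwise_cons pw andbT; apply/allP.
- rewrite perm_sort; case: (odd k); last by rewrite perm_cons perm_sym perm_sort.
  by rewrite perm_sym perm_rcons perm_cons perm_sort.
Qed.

End SortedSigmas.

(** * Sums of path weights and their recursion *)

Section PathWeights.
Variables (R : realType) (A : superAlgebra R) (n : nat) (D : decorated A).
Hypothesis hD : initial_zigzag n D.
Hypothesis hn : (3 <= n)%N.

Local Notation x j := (lam D [fset j; j.+1]).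
Local Notation y j := (lam D [fset j; j.+2]).
Local Notation w j := (wt_sigma D j).
Local Notation X j := (lam (flips n j D) [fset j; n]).
Local Notation box j := (mu (flips n j D) [fset j; j.+1; n]).
Local Notation B j := (ssqrt (X j * X j.+1 / x j) * box j).

(** The weight of an arc depends only on the parity of its step, so the boolean [b] serves as the
    step number. *)
Fixpoint arcs_wt (b : bool) (es : seq gedge) : A :=
  if es is e :: es' then wt_arc D b e * arcs_wt (~~ b) es' else 1.

Definition sigmas_wt (s : seq nat) : A := \prod_(j <- sort (pos_ge n) s) w j.

Definition edges_wt (es : seq gedge) : A := arcs_wt true es * sigmas_wt (sigmas es).

Lemma arcs_wtE c es :
  \prod_(0 <= s < size es) wt_arc D (s + c) (nth (Arc 0 0) es s) = arcs_wt (odd c) es.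
Proof.
elim: es c => [|e es IH] c; first by rewrite big_geq.
rewrite big_nat_recl //= -[~~ odd c]/(odd c.+1) -IH; congr (_ * _).
  by case: e => //= p q; rewrite oddb.
by apply: eq_bigr => s _; rewrite addSnnS.
Qed.

Lemma wt_with_vertices i es : wt n D (with_vertices i es) = edges_wt es.
Proof.
rewrite /wt /edges_wt /=; congr (_ * _).
rewrite big_add1 /= -[true]/(odd 1) -arcs_wtE.
by apply: eq_bigr => s _; rewrite addn1.
Qed.

Lemma sum_Tpaths f i : (0 < i < n)%N -> (n - i <= f)%N ->
  \sum_(t \in Tpaths n i) wt n D t = \sum_(es <- paths n f i) edges_wt es.
Proof.
move=> hi hf; rewrite (Tpaths_paths hi hf) -fsbig_seq.
  by rewrite big_map; apply: eq_bigr => es _; rewrite wt_with_vertices.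
by rewrite map_inj_uniq ?paths_uniq // => es es' [].
Qed.

Lemma prod_sigma_parity (s : seq nat) : all (fun j => 0 < j <= n - 2)%N s ->
  \prod_(j <- s) w j \in if odd (size s) then odd_part A else even_part A.
Proof.
elim: s => [|j s IH] /=; first by rewrite big_nil even_one.
move=> /andP[hj /IH]; rewrite big_cons; have := wt_sigma_odd hD hj.
case: (odd (size s)) => /= oj os; [exact: odd_mul_odd|exact: odd_mul_even].
Qed.

Lemma sigmas_range m es : all (edge_ok n m) es ->
  all (fun j => m <= j <= n - 2)%N (sigmas es).
Proof. by elim: es => //= -[p q|j|j l] es IH /= /andP[h /IH]; rewrite /= ?h. Qed.

Lemma sigmas_wt_even m es : (0 < m < n)%N -> sound n m es ->
  sigmas_wt (sigmas es) \in even_part A.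
Proof.
move=> hm hs; have := prod_sigma_parity (s := sort (pos_ge n) (sigmas es)).
rewrite size_sort (negPf (sound_even hs)); apply.
rewrite all_sort; apply: sub_all (sigmas_range (walk_edge_ok (sound_walk hs))) => j /=.
lia.
Qed.

Lemma edges_wt_straight k es :
  edges_wt [:: Arc k k.+1, Arc k.+1 k.+2 & es] = x k / x k.+1 * edges_wt es.
Proof. by rewrite /edges_wt /= !mulrA. Qed.

(** When the arc is cancelled, the missing inverse of x_{k+1} is balanced by the missing factor
    x_{k+1} at the head, so both forms of the detour multiply the weight alike. *)
Lemma edges_wt_detour k es : (0 < k)%N -> (k.+3 <= n)%N ->
  edges_wt (detour k es) = y k / x k.+1 * edges_wt es.
Proof.
move=> k0 hk; rewrite /detour; case: eqP => hd; last by rewrite /edges_wt /= !mulrA.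
case: es hd => //= _ es [->]; rewrite /edges_wt /= !mulrA divrK //.
by apply: even_pos_unit; apply: (side_pos hD); lia.
Qed.

(** The tail contributes an even number of odd generators, whose product is central, so it does not
    matter on which side of them sigma_l is placed; sigma_k then goes to the end prescribed by the
    parity of [k]. *)
Lemma edges_wt_sigma k l es : (0 < k < l)%N -> (l <= n - 2)%N -> sound n l.+1 es ->
  edges_wt [:: Arc k k.+1, Sigma k, Tau k l, Sigma l & es]
  = x k * (edges_wt es * (if odd k then w l * w k else w k * w l)).
Proof.
move=> hk hl hs; rewrite /edges_wt /= !mul1r -[LHS]mulrA -[in RHS](mulrA (arcs_wt _ _)).
congr (_ * (_ * _)).
have ev := sigmas_wt_even (m := l.+1) ltac:(lia) hs.
have hr := sigmas_range (walk_edge_ok (sound_walk hs)).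
have El : sigmas_wt (l :: sigmas es) = sigmas_wt (sigmas es) * w l.
  rewrite {1}/sigmas_wt sort_pos_cons //; try lia.
  case: ifP => _; first by rewrite -cats1 big_cat big_seq1.
  by rewrite big_cons (even_central _ ev).
rewrite {1}/sigmas_wt sort_pos_cons; [|lia| |lia].
  case: ifP => _; first by rewrite -cats1 big_cat big_seq1 /= -/(sigmas_wt _) El -[LHS]mulrA.
  by rewrite big_cons -/(sigmas_wt _) El (even_mulCA _ _ ev).
by rewrite /= hl andbT; apply/andP; split; [lia|apply: sub_all hr => j /=; lia].
Qed.

(** Unrolls B_k = B_{k+1} + X_{k+1} w_k until B_{n-2} = X_{n-1} w_{n-2} is reached. *)
Lemma box_sum k : (0 < k <= n - 2)%N -> B k = \sum_(k <= i < n.-1) X i.+1 * w i.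
Proof.
move Ed : (n - 2 - k)%N => d; elim: d k Ed => [|d IH] k Ed hk; last first.
  have [-> _] := fan_rec hD (k := k) ltac:(lia) ltac:(lia).
  rewrite IH; [|lia|lia].
  by rewrite [RHS]big_ltn; [rewrite addrC|lia].
have En : n = k.+2 by lia.
rewrite big_ltn ?big_geq ?addr0; [|lia|lia].
rewrite !flips_id; [|lia|lia].
have px := side_pos hD (j := k) ltac:(lia) hn; have py := skip_pos hD (j := k) ltac:(lia).
have px1 := side_pos hD (j := k.+1) ltac:(lia) hn.
rewrite [in LHS]En [in RHS]En /wt_sigma mulrA; congr (_ * _).
exact: ptolemy_base.
Qed.

(** Each term of the recursion for X_k is the total weight of one family in [paths]. Induction on
    the fuel makes the claim available for k+1, k+2 and every l+1 at once. *)
Lemma length_sum f k : (0 < k < n)%N -> (n - k <= f)%N ->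
  X k = \sum_(es <- paths n f k) edges_wt es.
Proof.
elim: f k => [|f IH] k hk hf; first lia.
have [hk2|hk2] := leqP n k.+2.
  rewrite paths_small ?big_seq1 /edges_wt /sigmas_wt /= ?big_nil ?mulr1; [|lia|lia].
  by rewrite flips_id //; lia.
have [_ ->] := fan_rec hD (k := k) ltac:(lia) ltac:(lia).
rewrite /= (_ : (n <= k.+2)%N = false); last lia.
rewrite !big_cat !big_map big_allpairs_dep /= -addrA; congr (_ + (_ + _)).
- rewrite (IH k.+2) ?big_distrr; [|lia|lia].
  by apply: eq_bigr => es _; rewrite edges_wt_straight.
- rewrite (IH k.+1) ?big_distrr; [|lia|lia].
  by apply: eq_bigr => es _; rewrite edges_wt_detour //; lia.
(* The product {B_{k+1}, w_k} is expanded by [box_sum]; the lengths X_{i+1} are central. *)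
transitivity (x k * \sum_(k.+1 <= i < n.-1) X i.+1 * (if odd k then w i * w k else w k * w i)).
  congr (_ * _); rewrite box_sum; last lia.
  case: ifP => _.
    by rewrite big_distrl; apply: eq_bigr => i _; rewrite /= mulrA.
  rewrite big_distrr /= !big_nat; apply: eq_bigr => i hi.
  have [[e _] _] := fan_positive hD (k := i.+1) hn ltac:(lia).
  by rewrite (even_mulCA _ _ e).
rewrite big_distrr /= -/(index_iota _ _) big_nat [RHS]big_nat; apply: eq_bigr => l hl.
rewrite (IH l.+1); [|lia|lia].
rewrite big_distrl big_distrr /= big_seq [RHS]big_seq; apply: eq_bigr => es hes.
rewrite edges_wt_sigma //; [lia|lia|].
by apply: paths_sound hes; lia.
Qed.

End PathWeights.

Theorem theorem6p5 (R : realType) (A : superAlgebra R) (n : nat)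
    (hn : (3 <= n)%N) (D : decorated A) (hD : initial_zigzag n D)
    (k : nat) (hk : (1 <= k <= n - 2)%N) :
  let lam_n (j : nat) : A := lam (flips n j D) [fset j; n] in
  let box : A := mu (flips n k D) [fset k; k.+1; n] in
  ssqrt (lam_n k * lam_n k.+1 / lam D [fset k; k.+1]) * box
    = \sum_(k <= i < n.-1) \sum_(t \in Tpaths n i.+1) wt n D t * wt_sigma D i
  /\
  lam_n k = \sum_(t \in Tpaths n k) wt n D t.
Proof.
move=> lam_n box; have [k0 k2] := andP hk.
have Xsum i : (0 < i < n)%N -> lam_n i = \sum_(t \in Tpaths n i) wt n D t.
  by move=> hi; rewrite (sum_Tpaths D hi (leq_subr i n)) -(length_sum hD hn hi (leq_subr i n)).
split; last by apply: Xsum; lia.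
rewrite /lam_n /box (box_sum hD hn hk) !big_nat; apply: eq_bigr => i hi.
have hi1 : (0 < i.+1 < n)%N by lia.
(* Sums over the set of T-paths become sums over a duplicate-free list, where right multiplication
   distributes. *)
rewrite -/(lam_n i.+1) (Xsum _ hi1) (Tpaths_paths hi1 (leq_subr i.+1 n)).
have u : uniq [seq with_vertices i.+1 es | es <- paths n n i.+1].
  by rewrite map_inj_uniq; [apply: paths_uniq; lia|move=> es es' []].
by rewrite -!fsbig_seq // big_distrl.
Qed.
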